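(* Let $(X,A)$ be a relative gathered CW complex of dimension $\leq N$, with inclusion $A\subset X$, and let $p\colon Y\to Z$ be an $N$-equivalence of diffeological spaces. Let $f'\colon A\to Y$ and $g\colon X\to Z$ be smooth maps and let $F'\colon A\times I\to Z$ be a tame homotopy such that $F'(a,0)=g(a)$ and $F'(a,1)=p(f'(a))$ for all $a\in A$. Then there exist a smooth map $f\colon X\to Y$ and a tame homotopy $G\colon X\times I\to Z$ such that $f|_A=f'$, $G|_{A\times I}=F'$, $G(x,0)=g(x)$ and $G(x,1)=p(f(x))$ for all $x\in X$.
   Context: All spaces are diffeological spaces and all maps are smooth unless said otherwise. $I=[0,1]$; $I^n$ and $\partial I^n$ carry the subspace diffeology of $\mathbf{R}^n$; products, coproducts, pushouts and colimits are taken in the category of diffeological spaces. Tame maps: let $K$ be a cubical subcomplex of $I^n$. A smooth map $f\colon K\to X$ is $\epsilon$-tame ($0<\epsilon\le 1/2$) if for every $j$, every $\alpha\in\{0,1\}$ and every $(t_1,\dots,t_n)\in K$ with $|t_j-\alpha|\le\epsilon$ one has $f(t_1,\dots,t_j,\dots,t_n)=f(t_1,\dots,\alpha,\dots,t_n)$ ($\alpha$ in the $j$-th place). A homotopy (smooth map) $F\colon X\times I\to Y$ is $\epsilon$-tame if $F(x,t)=F(x,\alpha)$ for all $x\in X$ and all $t\in I$ with $|t-\alpha|\le\epsilon$, $\alpha\in\{0,1\}$. ''Tame'' means $\epsilon$-tame for some $\epsilon>0$. Smooth relative CW complex: a pair $(X,A)$ of diffeological spaces with a sequence of inclusions (skeleta)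 $A=X^{-1}\to X^0\to X^1\to\cdots$ such that the natural map $X^{-1}\to\mathrm{colim}\,X^n$ coincides with the inclusion $A\to X$, and for each $n\ge0$ there is a pushout square exhibiting $X^n$ as the pushout of $X^{n-1}\xleftarrow{\bigcup\phi_\lambda}\coprod_{\lambda\in\Lambda_n}\partial I^n\hookrightarrow\coprod_{\lambda\in\Lambda_n}I^n$. The maps $\phi_\lambda\colon\partial I^n\to X^{n-1}$ are the attaching maps and the induced maps $\Phi_\lambda\colon I^n\to X^n$ the characteristic maps. $(X,A)$ has dimension $n$ if $X=X^n$. It is gathered if all attaching maps are tame. Homotopy groups: $\pi_n(X,x_0)=[I^n,\partial I^n;X,x_0]$, the set of smooth homotopy classes of smooth maps of pairs; for $n=0$ this is the set $\pi_0X$ of path components. A smooth map $\phi\colon X\to Y$ is an $N$-equivalence if for all $x\in X$ the induced map $\phi_*\colon\pi_n(X,x)\to\pi_n(Y,\phi(x))$ is injective for $0\le n<N$ and surjective for $0\le n\le N$ (for $n=0$ this is a condition on $\pi_0X\to\pi_0Y$). *)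

(* Defs.v *)
From HB Require Import structures.
From mathcomp Require Import all_boot all_order all_algebra.
From mathcomp Require Import all_classical all_reals all_analysis.

Set Implicit Arguments.
Unset Strict Implicit.
Unset Printing Implicit Defensive.

Import Order.TTheory GRing.Theory Num.Theory.
Import numFieldNormedType.Exports.

Local Open Scope classical_set_scope.
Local Open Scope ring_scope.

Section SmoothFunctions.
Variable R : realType.
Implicit Types n : nat.

(* Differentiability is Frechet differentiability, and the derivative of [f]
   is [C^k] when its value in every direction is; for open [U] only the values
   of [f] on [U] matter. *)
Fixpoint Ck n (k : nat) (U : set 'rV[R]_n) (f : 'rV[R]_n -> R) : Prop :=
  if k is k'.+1 then
    (forall x, U x -> differentiable f x) /\
    (forall v, Ck k' U (fun x => 'D_v f x))
  else forall x, U x -> {for x, continuous f}.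

Definition Cinfty n (U : set 'rV[R]_n) (f : 'rV[R]_n -> R) : Prop :=
  forall k, Ck k U f.

Definition Cinfty_map m n (U : set 'rV[R]_m) (h : 'rV[R]_m -> 'rV[R]_n) : Prop :=
  forall j, Cinfty U (fun x => h x 0 j).

Lemma differentiable_near n (f g : 'rV[R]_n -> R) x :
  (\near x, f x = g x) -> differentiable f x -> differentiable g x.
Proof.
move=> fg df; have [dfc dfE] := (diff_locallyP x f).1 df.
have fgx : f x = g x := nbhs_singleton fg.
have dgE : g \o shift x = cst (g x) + 'd f x +o_ (0 : 'rV[R]_n) id.
  apply/eqaddoP => e e0; move/eqaddoP: dfE => /(_ e e0) dfE.
  have fg0 : \forall h \near (0 : 'rV[R]_n), f (h + x) = g (h + x).
    by have := fg; rewrite (near_shift 0) subr0.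
  near=> h; rewrite !fctE /= -(near fg0 h) // -fgx.
  by near: h; move: dfE; apply: filterS => h; rewrite !fctE.
have dgE' : 'd g x = 'd f x :> (_ -> _) by exact: diff_unique.
by apply/diff_locallyP; rewrite dgE'.
Unshelve. all: by end_near. Qed.

Lemma Ck_ext n k (U : set 'rV[R]_n) f g : open U ->
  (forall x, U x -> f x = g x) -> Ck k U f -> Ck k U g.
Proof.
move=> oU; have nfg (f' g' : 'rV[R]_n -> R) x : (forall x, U x -> f' x = g' x) -> U x ->
    \near x, f' x = g' x.
  by move=> fg Ux; apply: filterS (open_nbhs_nbhs (conj oU Ux)) => y /fg.
elim: k f g => [|k IH] f g fg /=.
  move=> cf x Ux; suff: g @ x --> f x by rewrite (fg _ Ux).
  exact: cvg_trans (near_eq_cvg (nfg f g x fg Ux)) (cf x Ux).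
move=> [df Df]; split=> [x Ux|v].
  by apply: differentiable_near (df x Ux); exact: nfg.
apply: IH (Df v) => x Ux; exact/near_eq_derive/nfg.
Qed.

Lemma CkW n k (U : set 'rV[R]_n) f : Ck k.+1 U f -> Ck k U f.
Proof.
elim: k f => [|k IH] f [df Df].
  by move=> x Ux; exact/differentiable_continuous/df.
by split=> // v; exact/IH/Df.
Qed.

Lemma Ck_sub n k (U V : set 'rV[R]_n) f : V `<=` U -> Ck k U f -> Ck k V f.
Proof.
move=> VU; elim: k f => [|k IH] f /=; first by move=> cf x /VU/cf.
by move=> [df Df]; split=> [x /VU/df//|v]; exact/IH/Df.
Qed.

Lemma Ck_cst n k (U : set 'rV[R]_n) (c : R) : Ck k U (cst c).
Proof.
elim: k c => [|k IH] c /=; first by move=> x _; exact: cst_continuous.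
split=> [x _|v]; first exact: differentiable_cst.
by rewrite (_ : (fun x => _) = cst 0) // funeqE => x; rewrite derive_cst.
Qed.

Lemma Ck_coord n k (U : set 'rV[R]_n) j :
  Ck k U (fun x : 'rV[R]_n => x 0 j).
Proof.
case: k => [|k] /=; first by move=> x _; exact: coord_continuous.
split=> [x _|v]; first exact: differentiable_coord.
rewrite (_ : (fun x => _) = cst (v 0 j)); first exact: Ck_cst.
rewrite funeqE => x; have := @derive_id _ 'rV[R]_n x v.
by rewrite derive_mx; [move/matrixP => /(_ 0 j); rewrite mxE|exact: derivable_id].
Qed.

Lemma CkD n k (U : set 'rV[R]_n) f g : open U ->
  Ck k U f -> Ck k U g -> Ck k U (fun x => f x + g x).
Proof.
move=> oU; elim: k f g => [|k IH] f g /=.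
  by move=> cf cg x Ux; exact: (cvgD (cf x Ux) (cg x Ux)).
move=> [df Df] [dg Dg]; split=> [x Ux|v].
  by apply: differentiableD; [exact: df|exact: dg].
apply: (Ck_ext oU _ (IH _ _ (Df v) (Dg v))) => x Ux.
by rewrite deriveD //; apply: diff_derivable; [exact: df|exact: dg].
Qed.

Lemma CkM n k (U : set 'rV[R]_n) f g : open U ->
  Ck k U f -> Ck k U g -> Ck k U (fun x => f x * g x).
Proof.
move=> oU; elim: k f g => [|k IH] f g.
  by move=> cf cg x Ux; exact: (cvgM (cf x Ux) (cg x Ux)).
move=> Cf Cg; have [df Df] := Cf; have [dg Dg] := Cg; split=> [x Ux|v].
  by apply: differentiableM; [exact: df|exact: dg].
apply: (Ck_ext oU _ (CkD oU (IH _ _ (CkW Cf) (Dg v)) (IH _ _ (CkW Cg) (Df v)))).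
move=> x Ux.
by rewrite deriveM //; apply: diff_derivable; [exact: df|exact: dg].
Qed.

Lemma Ck_sum n k (U : set 'rV[R]_n) (I : Type) (s : seq I)
    (f : I -> 'rV[R]_n -> R) :
  open U -> (forall i, Ck k U (f i)) -> Ck k U (fun x => \sum_(i <- s) f i x).
Proof.
move=> oU Cf; elim: s => [|i s IH].
  by apply: (Ck_ext oU _ (Ck_cst k U 0)) => x _; rewrite big_nil.
by apply: (Ck_ext oU _ (CkD oU (Cf i) IH)) => x _; rewrite big_cons.
Qed.

Lemma continuous_rV m n (h : 'rV[R]_m -> 'rV[R]_n) x :
  (forall j, {for x, continuous (fun y => h y 0 j)}) -> {for x, continuous h}.
Proof.
move=> ch; suff: h @ x --> h x by [].
have FF : ProperFilter (nbhs x) by exact: nbhs_pfilter.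
apply/(@cvgrPdist_le _ _ _ (nbhs x) FF) => e e0; near=> y.
rewrite /Num.Def.normr/= mx_normrE (bigmax_le _ (ltW e0))//= => i _.
rewrite !mxE; move: i; near: y; apply: filter_forall => -[i j] /=.
by rewrite ord1; exact: ((cvgrPdist_le _ _).1 (ch j)).
Unshelve. all: by end_near. Qed.

Lemma differentiable_rV m n (h : 'rV[R]_m -> 'rV[R]_n) x :
  (forall j, differentiable (fun y => h y 0 j) x) -> differentiable h x.
Proof.
move=> dh; rewrite (_ : h = \sum_j (fun y => h y 0 j *: delta_mx 0 j)).
  by apply: differentiable_sum => j; exact: differentiableZl.
by rewrite funeqE => y; rewrite fct_sumE [LHS]row_sum_delta.
Qed.

Lemma derive_comp m n (f : 'rV[R]_n -> R) (h : 'rV[R]_m -> 'rV[R]_n) x v :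
  (forall j, differentiable (fun y => h y 0 j) x) -> differentiable f (h x) ->
  'D_v (f \o h) x =
    \sum_j 'D_v (fun y => h y 0 j) x * 'D_(delta_mx 0 j) f (h x).
Proof.
move=> dhj df; have dh := differentiable_rV dhj.
rewrite deriveE; last exact: differentiable_comp.
rewrite diff_comp //= -(deriveE _ dh) [X in 'd f _ X]row_sum_delta linear_sum.
apply: eq_bigr => j _; rewrite linearZ /= -(deriveE _ df).
by rewrite derive_mx ?mxE //; exact: diff_derivable.
Qed.

Lemma Ck_comp m n k (U : set 'rV[R]_n) (V : set 'rV[R]_m) f h :
  open V -> (forall x, V x -> U (h x)) ->
  Ck k U f -> (forall j, Ck k V (fun x => h x 0 j)) -> Ck k V (f \o h).
Proof.
move=> oV VU; elim: k f => [|k IH] f.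
  move=> cf ch x Vx; apply: continuous_comp; last exact/cf/VU.
  by apply: continuous_rV => j; exact: ch.
move=> Cf Ch; have [df Df] := Cf; split=> [x Vx|v].
  apply: differentiable_comp; last exact/df/VU.
  by apply: differentiable_rV => j; have [dh _] := Ch j; exact: dh.
have Dhf j : Ck k V (fun x =>
    'D_v (fun y => h y 0 j) x * 'D_(delta_mx 0 j) f (h x)).
  apply: CkM => //; first by have [_ Dh] := Ch j; exact: Dh.
  exact: (IH _ (Df _) (fun i => CkW (Ch i))).
apply: (Ck_ext oV _ (Ck_sum _ oV Dhf)) => x Vx.
by rewrite derive_comp // => [j|]; [have [dh _] := Ch j; exact: dh|exact/df/VU].
Qed.

Lemma Ck_local n k (U : set 'rV[R]_n) f :
  (forall x, U x -> exists V, [/\ V x, V `<=` U & Ck k V f]) -> Ck k U f.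
Proof.
elim: k f => [|k IH] f Uf; first by move=> x /Uf[V [Vx _ cf]]; exact: cf.
split=> [x /Uf[V [Vx _ [df _]]]|v]; first exact: df.
by apply: IH => x /Uf[V [Vx VU [_ Df]]]; exists V; split=> //; exact: Df.
Qed.

Lemma open_Cinfty_preimage m n (U : set 'rV[R]_n) (V : set 'rV[R]_m) h :
  open U -> open V -> Cinfty_map V h -> open (V `&` h @^-1` U).
Proof.
move=> oU oV Ch; rewrite openE => x [Vx Uhx]; apply: filterI.
  exact: open_nbhs_nbhs.
have ch : {for x, continuous h} by apply: continuous_rV => j; exact: (Ch j 0%N).
exact: (ch U (open_nbhs_nbhs (conj oU Uhx))).
Qed.

End SmoothFunctions.

(* A plot on an open set [U] of [R^n] is presented as a total function of which
   only the values on [U] are relevant ([plot_ext]); this loses nothing, since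
   a space with a plot on a nonempty open set is itself nonempty. *)
Record diffSpace (R : realType) := DiffSpace {
  carrier :> Type;
  plot : forall n, set 'rV[R]_n -> ('rV[R]_n -> carrier) -> Prop;
  plot_open : forall n U p, @plot n U p -> open U;
  plot_ext : forall n U p q, @plot n U p ->
    (forall x, U x -> p x = q x) -> @plot n U q;
  plot_cst : forall n U c, open U -> @plot n U (cst c);
  plot_local : forall n U p, open U ->
    (forall x, U x -> exists V, [/\ V x, V `<=` U & @plot n V p]) ->
    @plot n U p;
  plot_comp : forall m n U p V h, @plot n U p -> open V ->
    @Cinfty_map R m n V h -> (forall x, V x -> U (h x)) -> @plot m V (p \o h)
}.

Definition smooth (R : realType) (X Y : diffSpace R) (f : X -> Y) : Prop :=
  forall n (U : set 'rV[R]_n) (p : 'rV[R]_n -> X), plot U p -> plot U (f \o p).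

Section Constructions.
Variable R : realType.

Section Real.

Let rplot n (U : set 'rV[R]_n) (p : 'rV[R]_n -> R) := open U /\ Cinfty U p.

Lemma real_plot_open n U p : @rplot n U p -> open U. Proof. by case. Qed.

Lemma real_plot_ext n U p q : @rplot n U p ->
  (forall x, U x -> p x = q x) -> rplot U q.
Proof. by move=> [oU Cp] pq; split=> // k; exact: Ck_ext pq (Cp k). Qed.

Lemma real_plot_cst n U c : open U -> @rplot n U (cst c).
Proof. by move=> oU; split=> // k; exact: Ck_cst. Qed.

Lemma real_plot_local n U p : open U ->
  (forall x, U x -> exists V, [/\ V x, V `<=` U & @rplot n V p]) -> rplot U p.
Proof.
move=> oU Up; split=> // k; apply: Ck_local => x /Up[V [Vx VU [_ Cp]]].
by exists V; split.
Qed.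

Lemma real_plot_comp m n U p V h : @rplot n U p -> open V ->
  @Cinfty_map R m n V h -> (forall x, V x -> U (h x)) -> rplot V (p \o h).
Proof.
move=> [_ Cp] oV Ch VU; split=> // k.
by apply: (Ck_comp oV VU (Cp k)) => j; exact: Ch.
Qed.

Definition realSpace : diffSpace R :=
  DiffSpace real_plot_open real_plot_ext real_plot_cst real_plot_local
    real_plot_comp.

End Real.

Section Power.
Variable d : nat.

Let rplot n (U : set 'rV[R]_n) (p : 'rV[R]_n -> 'rV[R]_d) :=
  open U /\ Cinfty_map U p.

Lemma eucl_plot_open n U p : @rplot n U p -> open U. Proof. by case. Qed.

Lemma eucl_plot_ext n U p q : @rplot n U p ->
  (forall x, U x -> p x = q x) -> rplot U q.
Proof.
move=> [oU Cp] pq; split=> // j k; apply: Ck_ext (Cp j k) => // x Ux.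
by rewrite pq.
Qed.

Lemma eucl_plot_cst n U c : open U -> @rplot n U (cst c).
Proof. by move=> oU; split=> // j k; exact: Ck_cst. Qed.

Lemma eucl_plot_local n U p : open U ->
  (forall x, U x -> exists V, [/\ V x, V `<=` U & @rplot n V p]) -> rplot U p.
Proof.
move=> oU Up; split=> // j k; apply: Ck_local => x /Up[V [Vx VU [_ Cp]]].
by exists V; split=> //; exact: Cp.
Qed.

Lemma eucl_plot_comp m n U p V h : @rplot n U p -> open V ->
  @Cinfty_map R m n V h -> (forall x, V x -> U (h x)) -> rplot V (p \o h).
Proof.
move=> [_ Cp] oV Ch VU; split=> // j k.
by apply: (Ck_comp oV VU (Cp j k)) => i; exact: Ch.
Qed.

Definition euclSpace : diffSpace R :=
  DiffSpace eucl_plot_open eucl_plot_ext eucl_plot_cst eucl_plot_local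
    eucl_plot_comp.

End Power.

Section Subspace.
Variables (X : diffSpace R) (A : set X).

Let splot n (U : set 'rV[R]_n) (p : 'rV[R]_n -> A) :=
  plot U (fun x => val (p x)).

Lemma sub_plot_open n U p : @splot n U p -> open U.
Proof. exact: plot_open. Qed.

Lemma sub_plot_ext n U p q : @splot n U p ->
  (forall x, U x -> p x = q x) -> splot U q.
Proof. by move=> Up pq; apply: plot_ext Up _ => x Ux; rewrite pq. Qed.

Lemma sub_plot_cst n U c : open U -> @splot n U (cst c).
Proof. exact: plot_cst. Qed.

Lemma sub_plot_local n U p : open U ->
  (forall x, U x -> exists V, [/\ V x, V `<=` U & @splot n V p]) -> splot U p.
Proof. exact: plot_local. Qed.

Lemma sub_plot_comp m n U p V h : @splot n U p -> open V ->
  @Cinfty_map R m n V h -> (forall x, V x -> U (h x)) -> splot V (p \o h).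
Proof. exact: plot_comp. Qed.

Definition subSpace : diffSpace R :=
  DiffSpace sub_plot_open sub_plot_ext sub_plot_cst sub_plot_local
    sub_plot_comp.

End Subspace.

Section Product.
Variables X Y : diffSpace R.

Let pplot n (U : set 'rV[R]_n) (p : 'rV[R]_n -> X * Y) :=
  plot U (fst \o p) /\ plot U (snd \o p).

Lemma prod_plot_open n U p : @pplot n U p -> open U.
Proof. by move=> [/plot_open]. Qed.

Lemma prod_plot_ext n U p q : @pplot n U p ->
  (forall x, U x -> p x = q x) -> pplot U q.
Proof.
by move=> [Up1 Up2] pq; split; [apply: plot_ext Up1 _|apply: plot_ext Up2 _];
  move=> x Ux; rewrite /= pq.
Qed.

Lemma prod_plot_cst n U c : open U -> @pplot n U (cst c).
Proof. by move=> oU; split; exact: plot_cst. Qed.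

Lemma prod_plot_local n U p : open U ->
  (forall x, U x -> exists V, [/\ V x, V `<=` U & @pplot n V p]) -> pplot U p.
Proof.
by move=> oU Up; split; apply: plot_local => // x /Up[V [Vx VU [Vp1 Vp2]]];
  exists V.
Qed.

Lemma prod_plot_comp m n U p V h : @pplot n U p -> open V ->
  @Cinfty_map R m n V h -> (forall x, V x -> U (h x)) -> pplot V (p \o h).
Proof.
move=> [Up1 Up2] oV Ch VU; split.
- exact: (plot_comp Up1 oV Ch VU).
- exact: (plot_comp Up2 oV Ch VU).
Qed.

Definition prodSpace : diffSpace R :=
  DiffSpace prod_plot_open prod_plot_ext prod_plot_cst prod_plot_local
    prod_plot_comp.

End Product.

Section Coproduct.
Variables (L : Type) (X : L -> diffSpace R).

Let cplot n (U : set 'rV[R]_n) (p : 'rV[R]_n -> {l : L & X l}) :=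
  open U /\ forall x, U x -> exists V l (q : 'rV[R]_n -> X l),
    [/\ V x, V `<=` U, plot V q & forall y, V y -> p y = existT _ l (q y)].

Lemma coprod_plot_open n U p : @cplot n U p -> open U.
Proof. by case. Qed.

Lemma coprod_plot_ext n U p q : @cplot n U p ->
  (forall x, U x -> p x = q x) -> cplot U q.
Proof.
move=> [oU Up] pq; split=> // x /Up[V [l [r [Vx VU Vr pr]]]].
by exists V, l, r; split=> // y Vy; rewrite -pr// pq//; exact: VU.
Qed.

Lemma coprod_plot_cst n U c : open U -> @cplot n U (cst c).
Proof.
case: c => l c oU; split=> // x Ux.
by exists U, l, (cst c); split=> //; exact: plot_cst.
Qed.

Lemma coprod_plot_local n U p : open U ->
  (forall x, U x -> exists V, [/\ V x, V `<=` U & @cplot n V p]) -> cplot U p.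
Proof.
move=> oU Up; split=> // x /Up[V [Vx VU [_ Vp]]].
have [W [l [q [Wx WV Wq pq]]]] := Vp x Vx.
by exists W, l, q; split=> //; exact: subset_trans VU.
Qed.

Lemma coprod_plot_comp m n U p V h : @cplot n U p -> open V ->
  @Cinfty_map R m n V h -> (forall x, V x -> U (h x)) -> cplot V (p \o h).
Proof.
move=> [_ Up] oV Ch VU; split=> // x Vx.
have [W [l [q [Wx WU Wq pq]]]] := Up _ (VU x Vx).
exists (V `&` h @^-1` W), l, (q \o h); split=> [//||| y [_ /pq//]].
  by move=> y [].
apply: (plot_comp Wq) => [||y []//].
  exact: open_Cinfty_preimage (plot_open Wq) oV Ch.
by move=> j k; apply: Ck_sub (Ch j k) => y [].
Qed.

Definition coprodSpace : diffSpace R :=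
  DiffSpace coprod_plot_open coprod_plot_ext coprod_plot_cst coprod_plot_local
    coprod_plot_comp.

End Coproduct.

End Constructions.

Section Maps.
Variable R : realType.

Definition sub_incl (X : diffSpace R) (A B : set X) (AB : A `<=` B)
    (a : subSpace A) : subSpace B :=
  exist _ (val a) (mem_set (AB _ (set_mem (valP a)))).

Definition is_pushout (S A B P : diffSpace R)
    (f : S -> A) (g : S -> B) (u : A -> P) (v : B -> P) : Prop :=
  [/\ smooth f, smooth g, smooth u, smooth v & u \o f = v \o g] /\
  forall (W : diffSpace R) (h : A -> W) (k : B -> W),
    smooth h -> smooth k -> h \o f = k \o g ->
    exists! w : P -> W, [/\ smooth w, w \o u = h & w \o v = k].

Definition is_seq_colimit (X_ : nat -> diffSpace R)
    (j_ : forall n, X_ n -> X_ n.+1) (X : diffSpace R)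
    (i_ : forall n, X_ n -> X) : Prop :=
  (forall n, smooth (i_ n) /\ i_ n.+1 \o j_ n = i_ n) /\
  forall (W : diffSpace R) (h_ : forall n, X_ n -> W),
    (forall n, smooth (h_ n) /\ h_ n.+1 \o j_ n = h_ n) ->
    exists! w : X -> W, smooth w /\ forall n, w \o i_ n = h_ n.

Definition coprod_map (L : Type) (X Y : L -> diffSpace R)
    (f : forall l, X l -> Y l) (z : coprodSpace X) : coprodSpace Y :=
  existT _ (projT1 z) (f (projT1 z) (projT2 z)).

Definition cotuple (L : Type) (X : L -> diffSpace R) (Y : diffSpace R)
    (f : forall l, X l -> Y) (z : coprodSpace X) : Y :=
  f (projT1 z) (projT2 z).

End Maps.

Section Cubes.
Variable R : realType.

Definition unitI : diffSpace R :=
  subSpace (`[0, 1]%classic : set (realSpace R)).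

Lemma iend_subproof (a : bool) : (a%:R : R) \in `[0, 1]%classic.
Proof. by rewrite inE /= in_itv /=; case: a; rewrite /= ?lexx ?ler01. Qed.

Definition iend (a : bool) : unitI := exist _ (a%:R : R) (iend_subproof a).

Definition cube n : set (euclSpace R n) :=
  [set t : 'rV[R]_n | forall j, 0 <= t 0 j <= 1].

Definition bdcube n : set (euclSpace R n) :=
  [set t : 'rV[R]_n | cube t /\ exists j (a : bool), t 0 j = a%:R].

Lemma bdcube_cube n : @bdcube n `<=` @cube n.
Proof. by move=> t []. Qed.

Definition cubeSpace n := subSpace (@cube n).
Definition bdcubeSpace n := subSpace (@bdcube n).

Definition bd_incl n : bdcubeSpace n -> cubeSpace n :=
  sub_incl (@bdcube_cube n).

(* [s] is obtained from [t] by replacing its [j]-th coordinate by [a]; when [K]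
   is a cubical subcomplex of the cube this point always lies in [K] under the
   proximity assumption, as [e <= 1/2]. *)
Definition tame_map_eps n (K : set (euclSpace R n)) (X : diffSpace R)
    (f : subSpace K -> X) (e : R) : Prop :=
  0 < e <= 2^-1 /\
  forall (j : 'I_n) (a : bool) (t s : subSpace K),
    `|(val t : 'rV[R]_n) 0 j - a%:R| <= e ->
    (val s : 'rV[R]_n) =
      \row_i (if i == j then a%:R else (val t : 'rV[R]_n) 0 i) ->
    f t = f s.

Definition tame_map n (K : set (euclSpace R n)) (X : diffSpace R)
    (f : subSpace K -> X) : Prop := exists e, tame_map_eps f e.

Definition tame_homotopy_eps (X Y : diffSpace R)
    (F : prodSpace X unitI -> Y) (e : R) : Prop :=
  0 < e <= 2^-1 /\
  forall (x : X) (t : unitI) (a : bool),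
    `|(val t : R) - a%:R| <= e -> F (x, t) = F (x, iend a).

Definition tame_homotopy (X Y : diffSpace R)
    (F : prodSpace X unitI -> Y) : Prop :=
  smooth F /\ exists e, tame_homotopy_eps F e.

End Cubes.

Section CW.
Variables (R : realType) (X : diffSpace R) (A : set X).

(* [skel n] is the skeleton of dimension [n - 1], so that [skel 0] is [A]; the
   skeleta are regarded as subspaces of [X]. *)
Record relCW := RelCW {
  skel : nat -> set X;
  skel0 : skel 0 = A;
  skelS : forall n, skel n `<=` skel n.+1;
  skel_colimit : is_seq_colimit (fun n => sub_incl (@skelS n))
    (fun n (x : subSpace (skel n)) => val x);
  cell : nat -> Type;
  attach : forall n, cell n -> bdcubeSpace R n -> subSpace (skel n);
  charmap : forall n, cell n -> cubeSpace R n -> subSpace (skel n.+1);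
  skel_pushout : forall n, is_pushout
    (cotuple (@attach n)) (coprod_map (fun _ : cell n => @bd_incl R n))
    (sub_incl (@skelS n)) (cotuple (@charmap n))
}.

Definition gathered (C : relCW) : Prop :=
  forall n (l : cell C n), tame_map (attach l).

Definition has_dim (C : relCW) (n : nat) : Prop := skel C n.+1 = setT.

Definition dim_le (C : relCW) (N : nat) : Prop :=
  exists2 n, (n <= N)%N & has_dim C n.

End CW.

Section HomotopyGroups.
Variable R : realType.

Definition path_connected (X : diffSpace R) (x y : X) : Prop :=
  exists c : unitI R -> X,
    [/\ smooth c, c (iend R false) = x & c (iend R true) = y].

Definition pi0 (X : diffSpace R) : set (set X) :=
  [set C | exists x : X, C = [set y | path_connected x y]].

Definition pi0_map (X Y : diffSpace R) (phi : X -> Y) (C : set X) : set Y :=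
  [set y | exists2 x, C x & path_connected (phi x) y].

Definition pair_map n (X : diffSpace R) (x0 : X) (f : cubeSpace R n -> X) :
    Prop :=
  smooth f /\ forall t : bdcubeSpace R n, f (bd_incl t) = x0.

Definition pair_homotopic n (X : diffSpace R) (x0 : X)
    (f g : cubeSpace R n -> X) : Prop :=
  exists H : prodSpace (cubeSpace R n) (unitI R) -> X,
    [/\ smooth H, forall t, H (t, iend R false) = f t,
        forall t, H (t, iend R true) = g t &
        forall (t : bdcubeSpace R n) s, H (bd_incl t, s) = x0].

Definition pair_class n (X : diffSpace R) (x0 : X) (f : cubeSpace R n -> X) :
    set (cubeSpace R n -> X) :=
  [set g | pair_map x0 g /\ pair_homotopic x0 f g].

Definition pi_n n (X : diffSpace R) (x0 : X) : set (set (cubeSpace R n -> X)) :=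
  [set C | exists2 f, pair_map x0 f & C = pair_class x0 f].

(* Since homotopy is an equivalence relation compatible with [phi], this sends
   the class of [f] to the class of [phi \o f]. *)
Definition pi_map n (X Y : diffSpace R) (phi : X -> Y) (x0 : X)
    (C : set (cubeSpace R n -> X)) : set (cubeSpace R n -> Y) :=
  [set g | exists2 f, C f & pair_class (phi x0) (phi \o f) g].

Arguments pi0 X _ : clear implicits.
Arguments pi_n n {X} x0 _.

(* In degree [0] the condition bears on the unpointed sets of path components,
   so it is not vacuous when [X] is empty. *)
Definition N_equivalence (X Y : diffSpace R) (N : nat) (phi : X -> Y) : Prop :=
  [/\ smooth phi,
      ((0 < N)%N -> set_inj (pi0 X) (pi0_map phi)) /\
        set_surj (pi0 X) (pi0 Y) (pi0_map phi) &
      forall (x : X) n, (0 < n)%N ->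
        ((n < N)%N -> set_inj (pi_n n x) (pi_map phi x)) /\
        ((n <= N)%N -> set_surj (pi_n n x) (pi_n n (phi x)) (pi_map phi x))].

End HomotopyGroups.

Arguments pi0 {R} X _.
Arguments pi_n {R} n {X} x0 _.

(* Main.v *)
Require Import Defs.
From HB Require Import structures.
From mathcomp Require Import all_boot all_order all_algebra.
From mathcomp Require Import all_classical all_reals all_analysis.
From mathcomp Require Import ring lra.

Set Implicit Arguments.
Unset Strict Implicit.
Unset Printing Implicit Defensive.

Import Order.TTheory GRing.Theory Num.Theory.
Import numFieldNormedType.Exports.

Local Open Scope classical_set_scope.
Local Open Scope ring_scope.

(* Tameness of the attaching map lets the data on the boundary of a cell extend
   to a neighbourhood of the boundary, by precomposition with a smooth map that
   collapses a collar onto the boundary. On R^n the cell problem is then: [a] is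
   a map to Y near the boundary of the cube, [c : R^n -> Z] agrees with [p a]
   there; extend [a] to [h] with [p h] homotopic to [c] relative to a
   neighbourhood of the boundary. A homotopy extending [B] from the boundary is
   simply [B(x, t w(x))] for a bump function [w].
   To solve the problem, collapse all faces but the top one to a point. The top
   face then gives a class of pi_(n-1) Y which [c] kills in Z, so it is killed in
   Y, and this gives a first extension [h0]. The difference of [c] and [p h0] is
   a class of pi_n Z; adding a preimage in pi_n Y to [h0] gives [h].
   The homotopies of all cells are assembled by regarding them as maps to a space
   of e-tame paths: its elements are uniformly tame, and the pushout property of
   a skeleton applies to maps into it. Passing one skeleton up divides e by 4. *)

(** * Smooth step functions *)

(** The degrees fit exactly: a cell of dimension n > 0 uses injectivity of p on pi_(n-1), available
    since n - 1 < N, and surjectivity on pi_n, available since n <= N. The obstacle is gluing. Maps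
    that agree on a common face need not glue to a smooth map, and a cube times I has no smooth
    retraction onto its bottom and walls, so the usual cellular argument does not carry over. Smooth
    maps do glue when they agree on the overlap of two D-open sets. This is why maps live on R^n
    instead of the cube, why boundary conditions are imposed on a neighbourhood of the boundary, and
    why the pieces of each construction are made to coincide on an overlap; margins such as 1/3 and
    2/3, or e/4, 3e/8 and e/2, are there for that. Collapsing a collar changes the starting map g.
    The change is undone during a time interval in which the given homotopy is at rest, and tameness
    provides this interval. *)

Section SmoothStep.
Variable R : realType.

(** The functions t^(-k) exp(-1/t), extended by 0. The index [k] is there because the derivative of
    a member of the family is a combination of members with larger index, so that all orders of
    differentiability follow from one induction. *)
Definition flat (k : nat) (t : R) : R :=
  if 0 < t then t^-1 ^+ k * expR (- t^-1) else 0.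

Lemma flat_le0 k t : t <= 0 -> flat k t = 0.
Proof. by move=> t0; rewrite /flat ltNge t0. Qed.

Lemma flat_gt0 k t : 0 < t -> 0 < flat k t.
Proof. by move=> t0; rewrite /flat t0 mulr_gt0 ?exprn_gt0 ?invr_gt0 ?expR_gt0. Qed.

Lemma flat_ge0 k t : 0 <= flat k t.
Proof. by have [/flat_le0->//|/flat_gt0/ltW] := leP t 0. Qed.

(** From exp u >= u^(k+2) / (k+2)! with u = 1/t. A quadratic bound makes the difference quotient at
    0 tend to 0. *)
Lemma flat_le_sqr k t : flat k t <= k.+2`!%:R * t ^+ 2.
Proof.
have [t0|t0] := leP t 0; first by rewrite flat_le0// mulr_ge0 ?ler0n ?sqr_ge0.
rewrite /flat t0; set u := t^-1.
have u0 : 0 < u by rewrite invr_gt0.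
apply: (@le_trans _ _ (u ^+ k * (k.+2`!%:R / u ^+ k.+2))).
  rewrite ler_pM2l ?exprn_gt0// expRN -[leRHS]invf_div lef_pV2 ?posrE ?expR_gt0//.
    by apply: le_trans (expR_ge1Dxn k.+1 (ltW u0)); rewrite lerDr.
  by rewrite divr_gt0 ?exprn_gt0// ltr0n fact_gt0.
rewrite mulrCA ler_pM2l ?ltr0n ?fact_gt0// -addn2 exprD invfM.
by rewrite mulVKf ?expf_neq0 ?gt_eqF// /u exprVn invrK.
Qed.

Lemma is_derive_flat k (t : R) :
  is_derive t (1 : R) (flat k) (flat k.+2 t - k%:R * flat k.+1 t).
Proof.
have [t0|t0|->] := ltgtP t 0.
- rewrite !flat_le0 ?(ltW t0)// mulr0 subr0.
  apply: (@near_eq_is_derive _ _ _ (cst 0)) => /=.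
  near=> s; rewrite flat_le0//; apply/ltW; near: s; exact: lt_nbhsl.
- have dV : is_derive t (1 : R) (fun s : R => s^-1) (- t ^- 2).
    have := @is_deriveV R id t 1 1 (lt0r_neq0 t0) (is_derive_id _ _).
    by rewrite /GRing.scale /= mulr1 => H; exact: H.
  have dX := is_deriveX k dV.
  have dN : is_derive t (1 : R) (fun s : R => - s^-1) (t ^- 2).
    by have := is_deriveN dV; rewrite opprK.
  have dE : is_derive t (1 : R) (fun s : R => expR (- s^-1)) (t ^- 2 * expR (- t^-1)).
    have := @is_derive1_comp R expR (fun s => - s^-1) t _ _ (is_derive_expR _) dN.
    by rewrite mulrC => H; exact: H.
  have := is_deriveM dX dE.
  set a := (X in is_derive _ _ _ X -> _); set b := (X in _ -> is_derive _ _ _ X).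
  suff -> : a = b.
    apply: near_eq_is_derive; near=> s; rewrite /flat ifT; first by rewrite !fctE.
    by near: s; exact: lt_nbhsr.
  rewrite /a /b /flat t0 /GRing.scale /=.
  rewrite fctE -exprVn; move: (t^-1) (expR _) => u E.
  by case: k {dX a b} => [|k] /=; rewrite ?expr0 ?exprS; ring.
- rewrite !flat_le0// mulr0 subr0.
  suff h : (fun h => h^-1 *: (flat k (h *: 1 + 0) - flat k 0)) @ 0^' --> (0 : R).
    by apply: DeriveDef; [apply/cvg_ex; exists 0|exact: cvg_lim h].
  apply/cvgrPdist_le => e e0; near=> h.
  have h0 : h != 0 by near: h; exact: nbhs_dnbhs_neq.
  rewrite sub0r normrN (flat_le0 _ (lexx 0)) subr0 addr0 /GRing.scale /= mulr1.
  rewrite normrM normfV ger0_norm ?flat_ge0//.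
  rewrite ler_pdivrMl ?normr_gt0//; apply: le_trans (flat_le_sqr _ _) _.
  rewrite -real_normK ?num_real// expr2 mulrCA ler_pM2l ?normr_gt0//.
  rewrite mulrC -ler_pdivlMr ?ltr0n ?fact_gt0//.
  near: h; apply: dnbhs0_le; rewrite divr_gt0// ltr0n fact_gt0//.
Unshelve. all: by end_near. Qed.

Lemma Ck_flat n k (U : set 'rV[R]_n) (f : 'rV[R]_n -> R) : open U ->
  Cinfty U f -> forall i, Ck k U (flat i \o f).
Proof.
move=> oU Cf; have dflat i t : differentiable (flat i) t.
  by apply/derivable1_diffP; exact: (@ex_derive _ _ _ _ _ _ _ (is_derive_flat i t)).
elim: k => [|k IH] i /=.
  move=> x Ux; apply: continuous_comp; first exact: (Cf 0%N).
  exact: differentiable_continuous.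
have [df Df] := Cf 1%N; split=> [x Ux|v].
  by apply: differentiable_comp => //; exact: df.
have CDf : Ck k U (fun x => 'D_v f x) by have [_ +] := Cf k.+1; exact.
have Cd : Ck k U (fun x => ((flat i.+2 \o f) x + (- i%:R) * (flat i.+1 \o f) x)
    * 'D_v f x).
  by apply: CkM => //; apply: CkD => //; apply: CkM => //; exact: Ck_cst.
apply: (Ck_ext oU _ Cd) => x Ux /=.
rewrite [RHS]deriveE; last by apply: differentiable_comp => //; exact: df.
rewrite diff_comp//; last exact: df.
rewrite /= -(deriveE _ (df _ Ux)); set w : R := 'D_v f x.
have -> : 'd (flat i) (f x) w = w *: 'd (flat i) (f x) (1 : R).
  by rewrite -linearZ /GRing.scale/= mulr1.
rewrite -deriveE//; have -> := @derive_val _ _ _ _ _ _ _ (is_derive_flat i (f x)).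
by rewrite /GRing.scale/= mulrC mulNr.
Qed.

Lemma CkV n k (U : set 'rV[R]_n) (f : 'rV[R]_n -> R) : open U ->
  (forall x, U x -> f x != 0) -> Ck k U f -> Ck k U (fun x => (f x)^-1).
Proof.
move=> oU f0; elim: k => [|k IH] Cf.
  by move=> x Ux; exact: (cvgV (f0 x Ux) (Cf x Ux)).
have [df Df] := Cf.
have dV x : U x -> differentiable (fun x => (f x)^-1) x.
  by move=> Ux; apply: differentiable_comp; [exact: df|];
     apply/derivable1_diffP; apply: derivableV => //; exact: f0.
split=> // v.
have CV := IH (CkW Cf).
have Cd : Ck k U (fun x => (-1 * ((f x)^-1 * (f x)^-1)) * 'D_v f x).
  apply: (CkM oU _ (Df v)); apply: (CkM oU _ (CkM oU CV CV)); exact: Ck_cst.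
apply: (Ck_ext oU _ Cd) => x Ux.
rewrite deriveV ?f0//; last by apply: diff_derivable; exact: df.
by rewrite /GRing.scale /= -exprVn expr2 mulN1r.
Qed.

Definition sstep (t : R) : R := flat 0 t / (flat 0 t + flat 0 (1 - t)).

Lemma sstep_den_gt0 t : 0 < flat 0 t + flat 0 (1 - t).
Proof.
have [t0|t0] := leP t 0.
  by rewrite ltr_wpDl ?flat_ge0// flat_gt0//; lra.
by rewrite ltr_pwDl ?flat_ge0// flat_gt0.
Qed.

Lemma sstep_le0 t : t <= 0 -> sstep t = 0.
Proof. by move=> t0; rewrite /sstep flat_le0// mul0r. Qed.

Lemma sstep_ge1 t : 1 <= t -> sstep t = 1.
Proof.
move=> t1; rewrite /sstep [X in _ + X]flat_le0 ?addr0 ?divff//; last lra.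
by rewrite gt_eqF// flat_gt0//; lra.
Qed.

Lemma sstep01 t : 0 <= sstep t <= 1.
Proof.
rewrite /sstep divr_ge0 ?flat_ge0 ?(ltW (sstep_den_gt0 _))//=.
by rewrite ler_pdivrMr ?sstep_den_gt0// mul1r lerDl flat_ge0.
Qed.

Lemma Ck_sstep n k (U : set 'rV[R]_n) (f : 'rV[R]_n -> R) : open U ->
  Cinfty U f -> Ck k U (sstep \o f).
Proof.
move=> oU Cf; apply: CkM => //; first exact: Ck_flat.
apply: CkV => // [x Ux|]; first by rewrite gt_eqF// sstep_den_gt0.
apply: CkD => //; first exact: Ck_flat.
apply: (@Ck_flat _ _ _ (fun x => 1 - f x)) => // i.
apply: CkD => //; first exact: Ck_cst.
have : Ck i U (fun x => -1 * f x) by apply: CkM => //; exact: Ck_cst.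
by apply: Ck_ext => // x _; rewrite mulN1r.
Qed.

End SmoothStep.

(** * Local criteria for smoothness *)

Section Calculus.
Variable R : realType.
Implicit Types X Y Z W : diffSpace R.

Lemma plot_sub X n (U V : set 'rV[R]_n) (p : 'rV[R]_n -> X) :
  plot U p -> open V -> V `<=` U -> plot V p.
Proof.
move=> Up oV VU; apply: (@plot_comp _ _ _ _ _ _ _ id Up oV _ VU) => j k.
exact: Ck_coord.
Qed.

(** Smoothness of the restriction to the subspace [A]. Keeping [f] total avoids carrying membership
    proofs along with the points. *)
Definition smooth_on X Y (A : set X) (f : X -> Y) : Prop :=
  forall n (U : set 'rV[R]_n) p, plot U p -> (forall u, U u -> A (p u)) ->
    plot U (f \o p).

(* Openness for the D-topology. *)
Definition dopen X (A : set X) : Prop :=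
  forall n (U : set 'rV[R]_n) p, plot U p -> open (U `&` p @^-1` A).

Lemma smooth_onT X Y (f : X -> Y) : smooth_on setT f <-> smooth f.
Proof. by split=> sf n U p Up; [apply: sf|move=> _; apply: sf]. Qed.

Lemma smoothW X Y (A : set X) (f : X -> Y) : smooth f -> smooth_on A f.
Proof. by move=> sf n U p Up _; apply: sf. Qed.

Lemma smooth_on_sub X Y (A B : set X) (f : X -> Y) : A `<=` B ->
  smooth_on B f -> smooth_on A f.
Proof. by move=> AB sf n U p Up pA; apply: sf => // u /pA /AB. Qed.

Lemma smooth_on_ext X Y (A : set X) (f g : X -> Y) :
  (forall x, A x -> f x = g x) -> smooth_on A f -> smooth_on A g.
Proof.
by move=> fg sf n U p Up pA; apply: plot_ext (sf _ _ _ Up pA) _ => x /pA/fg.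
Qed.

Lemma smooth_on_comp X Y Z (A : set X) (B : set Y) (g : Y -> Z) (f : X -> Y) :
  smooth_on B g -> smooth_on A f -> (forall x, A x -> B (f x)) ->
  smooth_on A (fun x => g (f x)).
Proof.
move=> sg sf AB n U p Up pA; apply: (sg _ _ _ (sf _ _ _ Up pA)) => u /pA.
exact: AB.
Qed.

Lemma smooth_comp_on X Y Z (A : set X) (g : Y -> Z) (f : X -> Y) :
  smooth g -> smooth_on A f -> smooth_on A (fun x => g (f x)).
Proof. by move=> sg sf n U p Up pA; exact: (sg _ _ _ (sf _ _ _ Up pA)). Qed.

Lemma smooth_comp X Y Z (g : Y -> Z) (f : X -> Y) :
  smooth g -> smooth f -> smooth (fun x => g (f x)).
Proof. by move=> sg sf n U p Up; exact/sg/sf. Qed.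

Lemma smooth_on_id X (A : set X) : smooth_on A (fun x => x).
Proof. by []. Qed.

Lemma smooth_on_cst X Y (A : set X) (y : Y) : smooth_on A (fun _ => y).
Proof. by move=> n U p Up _; exact: plot_cst (plot_open Up). Qed.

Lemma smooth_on_pair X Y Z (A : set X) (f : X -> Y) (g : X -> Z) :
  smooth_on A f -> smooth_on A g ->
  smooth_on A (fun x => (f x, g x) : prodSpace Y Z).
Proof. by move=> sf sg n U p Up pA; split; [exact: sf|exact: sg]. Qed.

Lemma smooth_on_fst X Y Z (A : set X) (f : X -> prodSpace Y Z) :
  smooth_on A f -> smooth_on A (fun x => (f x).1).
Proof. by move=> sf n U p Up pA; have [] := sf _ _ _ Up pA. Qed.

Lemma smooth_on_snd X Y Z (A : set X) (f : X -> prodSpace Y Z) :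
  smooth_on A f -> smooth_on A (fun x => (f x).2).
Proof. by move=> sf n U p Up pA; have [] := sf _ _ _ Up pA. Qed.

Lemma smooth_val X (A : set X) : @smooth R (subSpace A) X val.
Proof. by []. Qed.

(** Being a plot is a local property, and D-open sets pull back to open sets along plots. *)
Lemma smooth_on_patch X Y (D A B : set X) (f g h : X -> Y) :
  dopen A -> dopen B -> (forall x, D x -> A x \/ B x) ->
  smooth_on (D `&` A) g -> smooth_on (D `&` B) h ->
  (forall x, D x -> A x -> f x = g x) -> (forall x, D x -> B x -> f x = h x) ->
  smooth_on D f.
Proof.
move=> oA oB DAB sg sh fg fh n U p Up pD; apply: plot_local => [|u Uu].
  exact: plot_open Up.
have patch (E : set X) (k : X -> Y) : dopen E -> E (p u) ->
    smooth_on (D `&` E) k -> (forall x, D x -> E x -> f x = k x) ->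
    exists V, [/\ V u, V `<=` U & plot V (f \o p)].
  move=> oE Eu sk fk; exists (U `&` p @^-1` E); split=> //.
  have Vp : plot (U `&` p @^-1` E) p.
    by apply: plot_sub Up (oE _ _ _ Up) _ => x [].
  have Vk : plot (U `&` p @^-1` E) (k \o p).
    by apply: sk => // x [Ux Ex]; split=> //; exact: pD.
  by apply: plot_ext Vk _ => x [Ux Ex]; rewrite /= fk//; exact: pD.
by case: (DAB _ (pD _ Uu)) => ?; [exact: (patch A g)|exact: (patch B h)].
Qed.

Lemma smooth_patch X Y (A B : set X) (g h : X -> Y) :
  dopen A -> dopen B -> (forall x, A x \/ B x) ->
  smooth_on A g -> smooth_on B h -> (forall x, A x -> B x -> g x = h x) ->
  smooth (fun x => if `[< A x >] then g x else h x).
Proof.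
move=> oA oB AB sg sh gh; apply/smooth_onT.
apply: (@smooth_on_patch _ _ _ A B _ g h); rewrite ?setTI//.
  by move=> x _ Ax; rewrite asboolT.
by move=> x _ Bx; case: asboolP => // Ax; exact: gh.
Qed.

Lemma dopenI X (A B : set X) : dopen A -> dopen B -> dopen (A `&` B).
Proof.
move=> oA oB n U p Up.
rewrite preimage_setI -(setIid U) setIACA; apply: openI; [exact: oA|exact: oB].
Qed.

Lemma dopenU X (A B : set X) : dopen A -> dopen B -> dopen (A `|` B).
Proof.
move=> oA oB n U p Up; rewrite preimage_setU setIUr.
by apply: openU; [exact: oA|exact: oB].
Qed.

Lemma dopen_ex X (I : Type) (A : I -> set X) : (forall i, dopen (A i)) ->
  dopen [set x | exists i, A i x].
Proof.
move=> oA n U p Up; rewrite (_ : _ `&` _ = \bigcup_i (U `&` p @^-1` A i)).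
  by apply: bigcup_open => i _; exact: oA.
by apply/seteqP; split=> [x [Ux [i Ai]]|x [i _ [Ux Ai]]]; [exists i|split=> //; exists i].
Qed.

Lemma dopen_all X m (A : 'I_m -> set X) : (forall i, dopen (A i)) ->
  dopen [set x | forall i, A i x].
Proof.
move=> oA n U p Up; rewrite openE => x [Ux Ax]; apply: filterI.
  exact: open_nbhs_nbhs (conj (plot_open Up) Ux).
suff : \forall y \near x, forall i, A i (p y) by [].
apply: (@filter_forall _ _ (fun i y => A i (p y)) (nbhs x)) => i.
have : nbhs x (U `&` p @^-1` A i).
  by apply: open_nbhs_nbhs; split; [exact: oA|split=> //; exact: Ax].
by apply: filterS => y [].
Qed.

Lemma dopen_preimage X Y (f : X -> Y) (A : set Y) : smooth f -> dopen A ->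
  dopen [set x | A (f x)].
Proof. by move=> sf oA n U p Up; exact: (oA _ _ _ (sf _ _ _ Up)). Qed.

Section RealValued.
Variables (X : diffSpace R) (A : set X).
Local Notation smoothR f := (@smooth_on X (realSpace R) A f).

Lemma smooth_onD (f g : X -> R) : smoothR f -> smoothR g ->
  smoothR (fun x => f x + g x).
Proof.
move=> sf sg n U p Up pA; have [oU Cf] := sf _ _ _ Up pA.
by have [_ Cg] := sg _ _ _ Up pA; split=> // k; exact: CkD.
Qed.

Lemma smooth_onM (f g : X -> R) : smoothR f -> smoothR g ->
  smoothR (fun x => f x * g x).
Proof.
move=> sf sg n U p Up pA; have [oU Cf] := sf _ _ _ Up pA.
by have [_ Cg] := sg _ _ _ Up pA; split=> // k; exact: CkM.
Qed.

Lemma smooth_onN (f : X -> R) : smoothR f -> smoothR (fun x => - f x).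
Proof.
move=> sf; apply: (@smooth_on_ext _ _ _ (fun x => -1 * f x : realSpace R)).
  by move=> x _; rewrite mulN1r.
by apply: smooth_onM => //; exact: smooth_on_cst.
Qed.

Lemma smooth_on_sstep (f : X -> R) : smoothR f -> smoothR (fun x => sstep (f x)).
Proof.
by move=> sf n U p Up pA; have [oU Cf] := sf _ _ _ Up pA; split=> // k; exact: Ck_sstep.
Qed.

Lemma smooth_on_prod (I : Type) (s : seq I) (f : I -> X -> R) :
  (forall i, smoothR (f i)) -> smoothR (fun x => \prod_(i <- s) f i x).
Proof.
move=> sf; elim: s => [|i s IH].
  apply: (smooth_on_ext (f := fun=> 1 : realSpace R)) => [x _|].
    by rewrite big_nil.
  exact: smooth_on_cst.
apply: (smooth_on_ext _ (smooth_onM (sf i) IH)) => x _.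
by rewrite big_cons.
Qed.

Lemma smooth_on_rV n (f : X -> 'rV[R]_n) : (forall j, smoothR (fun x => f x 0 j)) ->
  @smooth_on X (euclSpace R n) A f.
Proof.
move=> sf m U p Up pA; split; first exact: plot_open Up.
by move=> j k; have [_ Cf] := sf j _ _ _ Up pA; exact: Cf.
Qed.

Lemma smooth_on_row n (F : X -> 'I_n -> R) : (forall j, smoothR (F^~ j)) ->
  @smooth_on X (euclSpace R n) A (fun x => \row_j F x j).
Proof.
move=> sF; apply: smooth_on_rV => j; apply: smooth_on_ext (sF j) => x _.
by rewrite mxE.
Qed.

Lemma smooth_on_coord n (f : X -> 'rV[R]_n) j :
  @smooth_on X (euclSpace R n) A f -> smoothR (fun x => f x 0 j).
Proof. by move=> sf m U p Up pA; have [oU Cf] := sf _ _ _ Up pA; split=> // k; exact: Cf. Qed.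

Lemma dopen_lt (f g : X -> R) : @smooth R X (realSpace R) f ->
  @smooth R X (realSpace R) g -> dopen [set x | f x < g x].
Proof.
move=> sf sg n U p Up; rewrite openE => x [Ux fg].
have [oU Cf] := sf _ _ _ Up; have [_ Cg] := sg _ _ _ Up.
apply: filterI; first exact: open_nbhs_nbhs.
have cfg : {for x, continuous (fun y => g (p y) - f (p y))}.
  apply: (@continuousB _ _ _ (g \o p) (f \o p)); [exact: (Cg 0%N)|exact: (Cf 0%N)].
have fg0 : 0 < g (p x) - f (p x) by rewrite subr_gt0.
have H : nbhs x [set y | 0 < g (p y) - f (p y)] := cfg _ (lt_nbhsr fg0).
by apply: (@filterS _ (nbhs x) _ _ _ _ H) => y /=; rewrite subr_gt0.
Qed.

End RealValued.

End Calculus.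

Lemma smooth_fst (R : realType) (X Y : diffSpace R) : @smooth R (prodSpace X Y) X fst.
Proof. by move=> n U p []. Qed.

Lemma smooth_snd (R : realType) (X Y : diffSpace R) : @smooth R (prodSpace X Y) Y snd.
Proof. by move=> n U p []. Qed.

Ltac smooth_step := first
  [ assumption | apply: smooth_on_cst | apply: smooth_on_id
  | apply: smoothW; first [assumption | exact: smooth_fst | exact: smooth_snd]
  | apply: smooth_on_pair | apply: smooth_on_sstep
  | match goal with H : smooth _ |- _ => apply: (smooth_comp_on H) end
  | apply: smooth_onD | apply: smooth_onN | apply: smooth_onM 
  | apply: smooth_on_coord
  | apply: smooth_on_fst | apply: smooth_on_snd
  | apply: smooth_on_row => ?].
Ltac smooth_tac := repeat smooth_step.

(** * Relative homotopies *)

Section RelativeHomotopy.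
Variable R : realType.
Implicit Types X Y Z W : diffSpace R.

(* The time runs over all of R and the homotopy is constant outside [0, 1], so
   that concatenation is smooth without further taming. *)
Definition homrel X W (D : set X) (f g : X -> W) : Prop :=
  exists K : prodSpace X (realSpace R) -> W,
    [/\ smooth K, forall x (s : R), s <= 0 -> K (x, s) = f x,
        forall x (s : R), 1 <= s -> K (x, s) = g x &
        forall x (s : R), D x -> K (x, s) = f x].

(** Composing the time with [sstep], whose values lie in [0, 1], makes any homotopy constant outside
    [0, 1]. *)
Lemma homrel_of X W (D : set X) (K : prodSpace X (realSpace R) -> W) f g :
  smooth K -> (forall x, K (x, 0) = f x) -> (forall x, K (x, 1) = g x) ->
  (forall x (s : R), D x -> 0 <= s <= 1 -> K (x, s) = f x) -> homrel D f g.
Proof.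
move=> sK Kf Kg KD; exists (fun z => K (z.1, sstep (z.2 : R))); split.
- by apply/smooth_onT; smooth_tac.
- by move=> x s s0 /=; rewrite sstep_le0.
- by move=> x s s1 /=; rewrite sstep_ge1.
- by move=> x s Dx /=; rewrite KD// sstep01.
Qed.

Lemma homrel_refl X W (D : set X) (f : X -> W) : smooth f -> homrel D f f.
Proof.
by move=> sf; exists (fun z => f z.1); split=> //; apply/smooth_onT; smooth_tac.
Qed.

Lemma homrel_sym X W (D : set X) (f g : X -> W) : homrel D f g -> homrel D g f.
Proof.
move=> [K [sK Kf Kg KD]]; exists (fun z => K (z.1, 1 - (z.2 : R))); split.
- by apply/smooth_onT; smooth_tac.
- by move=> x s s0 /=; rewrite Kg//; lra.
- by move=> x s s0 /=; rewrite Kf//; lra.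
- by move=> x s Dx /=; rewrite KD// -(KD _ 1 Dx) Kg.
Qed.

Lemma homrel_eq X W (D : set X) (f g : X -> W) x : homrel D f g -> D x -> f x = g x.
Proof. by move=> [K [_ _ Kg KD]] Dx; rewrite -(KD x 1 Dx) Kg. Qed.

Lemma dopen_time_lt X (a : R) :
  @dopen R (prodSpace X (realSpace R)) [set z | (z.2 : R) < a].
Proof. by apply: dopen_lt; apply/smooth_onT; smooth_tac. Qed.

Lemma dopen_time_gt X (a : R) :
  @dopen R (prodSpace X (realSpace R)) [set z | a < (z.2 : R)].
Proof. by apply: dopen_lt; apply/smooth_onT; smooth_tac. Qed.

Lemma homrel_trans X W (D : set X) (f g h : X -> W) :
  homrel D f g -> homrel D g h -> homrel D f h.
Proof.
move=> fg [L [sL Lg Lh LD]]; have fgD x := @homrel_eq _ _ _ _ _ x fg.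
move: fg => [K [sK Kf Kg KD]].
(* For times between 1/3 and 2/3 the first homotopy has finished and the second has not started, so
   both branches are [g]. *)
pose A := [set z : prodSpace X (realSpace R) | (z.2 : R) < 2 / 3].
exists (fun z => if `[< A z >] then K (z.1, 3 * (z.2 : R))
  else L (z.1, 3 * (z.2 : R) - 2)); split.
- apply: (@smooth_patch _ _ _ A [set z | 1 / 3 < (z.2 : R)]).
  + exact: dopen_time_lt.
  + exact: dopen_time_gt.
  + by move=> z; rewrite /A/=; case: (ltP (z.2 : R) (2/3)) => ?; [left|right; lra].
  + by smooth_tac.
  + by smooth_tac.
  + by rewrite /A => z /= Az Bz; rewrite Kg ?Lg//; lra.
- by move=> x s s0 /=; rewrite asboolT ?Kf//; rewrite /A /=; lra.
- by move=> x s s0 /=; rewrite asboolF ?Lh//; rewrite /A /=; lra.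
- by move=> x s Dx /=; case: asboolP => _; rewrite ?KD ?LD// fgD.
Qed.

Lemma homrel_sub X W (D D' : set X) (f g : X -> W) : D' `<=` D ->
  homrel D f g -> homrel D' f g.
Proof. by move=> DD' [K [sK Kf Kg KD]]; exists K; split=> // x s /DD'; exact: KD. Qed.

Lemma homrel_ext X W (D : set X) (f f' g g' : X -> W) : f =1 f' -> g =1 g' ->
  homrel D f g -> homrel D f' g'.
Proof.
move=> ff gg [K [sK Kf Kg KD]].
by exists K; split=> // x s; rewrite -?ff -?gg; auto.
Qed.

Lemma homrel_post X W W' (D : set X) (f g : X -> W) (p : W -> W') : smooth p ->
  homrel D f g -> homrel D (p \o f) (p \o g).
Proof.
move=> sp [K [sK Kf Kg KD]]; exists (p \o K); split=> [|x s /Kf|x s /Kg|x s /(KD x s)] /=.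
- exact: smooth_comp.
- by move=> ->.
- by move=> ->.
- by move=> ->.
Qed.

Lemma homrel_pre X X' W (D : set X) (D' : set X') (q : X' -> X) (f g : X -> W) :
  smooth q -> (forall x, D' x -> D (q x)) ->
  homrel D f g -> homrel D' (f \o q) (g \o q).
Proof.
move=> sq DD [K [sK Kf Kg KD]]; exists (fun z => K (q z.1, z.2)).
split=> [|x s /Kf|x s /Kg|x s /DD /KD] //=.
by apply/smooth_onT; smooth_tac.
Qed.

Lemma sstepI_subproof (t : R) : sstep t \in `[0, 1]%classic.
Proof. by rewrite inE /= in_itv /= sstep01. Qed.

Definition stepI (t : R) : unitI R := exist _ (sstep t) (sstepI_subproof t).

Lemma smooth_stepI : @smooth R (realSpace R) (unitI R) stepI.
Proof.
move=> n U q Uq; suff: plot U (fun x => sstep (q x : R) : realSpace R) by [].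
have: @smooth_on R (realSpace R) (realSpace R) setT (fun t => sstep (t : R)) by smooth_tac.
by move=> /smooth_onT; apply.
Qed.

Lemma stepI_le0 (t : R) : t <= 0 -> stepI t = iend R false.
Proof. by move=> t0; apply: val_inj; rewrite /= sstep_le0. Qed.

Lemma stepI_ge1 (t : R) : 1 <= t -> stepI t = iend R true.
Proof. by move=> t0; apply: val_inj; rewrite /= sstep_ge1. Qed.

(** Restriction of the time in one direction and [stepI] in the other. This is the link with the
    homotopies over I in the definition of the homotopy groups. *)
Lemma homrelP X W (D : set X) (f g : X -> W) : homrel D f g <->
  exists H : prodSpace X (unitI R) -> W,
    [/\ smooth H, forall x, H (x, iend R false) = f x,
        forall x, H (x, iend R true) = g x & forall x s, D x -> H (x, s) = f x].
Proof.
split=> [[K [sK Kf Kg KD]]|[H [sH Hf Hg HD]]].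
  exists (fun z => K (z.1, val z.2)); split=> [|x|x|x s Dx] /=.
  - have sv := @smooth_val R (realSpace R) `[0, 1]%classic.
    by apply/smooth_onT; smooth_tac.
  - by rewrite Kf.
  - by rewrite Kg.
  - by rewrite KD.
exists (fun z => H (z.1, stepI z.2)); split=> [|x s s0|x s s1|x s Dx] /=.
- by have sI := smooth_stepI; apply/smooth_onT; smooth_tac.
- by rewrite stepI_le0.
- by rewrite stepI_ge1.
- by rewrite HD.
Qed.

End RelativeHomotopy.

(** * Neighbourhoods of the boundary of the cube and cut-off functions *)

Section NearBoundary.
Variable R : realType.
Implicit Types (n : nat) (e : R).

(** For e > 0 it contains everything outside the cube, so a map on R^n that is prescribed there
    behaves like a map on the cube with prescribed boundary values. *)
Definition nearbd n e : set (euclSpace R n) :=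
  [set x : 'rV[R]_n | exists j, x 0 j < e \/ 1 - e < x 0 j].

Definition inner n e : set (euclSpace R n) :=
  [set x : 'rV[R]_n | forall j, e < x 0 j < 1 - e].

Lemma smooth_coord n j :
  @smooth R (euclSpace R n) (realSpace R) (fun x : 'rV[R]_n => x 0 j).
Proof. by apply/smooth_onT; smooth_tac. Qed.

Lemma smooth_cstR (X : diffSpace R) (c : R) : @smooth R X (realSpace R) (fun _ => c).
Proof. by apply/smooth_onT; smooth_tac. Qed.

Lemma dopen_nearbd n e : dopen (@nearbd n e).
Proof.
apply: dopen_ex => j; apply: dopenU; apply: dopen_lt;
  first [exact: smooth_coord|exact: smooth_cstR].
Qed.

Lemma dopen_inner n e : dopen (@inner n e).
Proof.
rewrite (_ : @inner n e = [set x : 'rV[R]_n | forall j, e < x 0 j] `&`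
    [set x : 'rV[R]_n | forall j, x 0 j < 1 - e]).
  apply: dopenI; apply: dopen_all => j; apply: dopen_lt;
  first [exact: smooth_coord|exact: smooth_cstR].
apply/seteqP; split=> [x ix|x [ix ix'] j]; last by apply/andP.
by split=> j; have /andP[] := ix j.
Qed.

Lemma nearbdW n e e' : e <= e' -> @nearbd n e `<=` nearbd e'.
Proof. by move=> ee x [j [h|h]]; exists j; [left|right]; lra. Qed.

Lemma notin_nearbd n e e' (x : euclSpace R n) : e' < e -> ~ nearbd e x -> inner e' x.
Proof.
move=> ee nx j; apply/andP; split; rewrite ltNge; apply/negP => h; apply: nx;
  exists j; [left|right]; lra.
Qed.

Lemma nearbdU n e e' (x : euclSpace R n) : e' < e -> nearbd e x \/ inner e' x.
Proof. by move=> ee; have [|/(notin_nearbd ee)] := pselect (nearbd e x); [left|right]. Qed.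

Definition ramp (a b t : R) : R := sstep ((t - a) / (b - a)).

Lemma ramp_le a b t : a < b -> t <= a -> ramp a b t = 0.
Proof. by move=> ab ta; rewrite /ramp sstep_le0// pmulr_lle0 ?invr_gt0; lra. Qed.

Lemma ramp_ge a b t : a < b -> b <= t -> ramp a b t = 1.
Proof. by move=> ab ta; rewrite /ramp sstep_ge1// ler_pdivlMr; lra. Qed.

Lemma ramp01 a b t : 0 <= ramp a b t <= 1. Proof. exact: sstep01. Qed.

Lemma smooth_ramp (X : diffSpace R) (A : set X) a b (f : X -> R) :
  @smooth_on R X (realSpace R) A f ->
  @smooth_on R X (realSpace R) A (fun x => ramp a b (f x)).
Proof. by move=> sf; rewrite /ramp; smooth_tac. Qed.

(** One minus a product of one-variable cut-offs: the product vanishes as soon as a single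
    coordinate is near 0 or 1. *)
Lemma ex_bump n e1 e2 : e1 < e2 -> exists w : euclSpace R n -> R,
  [/\ @smooth R (euclSpace R n) (realSpace R) w, forall x, 0 <= w x <= 1,
      forall x, nearbd e1 x -> w x = 1 & forall x, inner e2 x -> w x = 0].
Proof.
move=> e12; pose r t := ramp e1 e2 t * ramp e1 e2 (1 - t).
have r01 t : 0 <= r t <= 1.
  by have /andP[? ?] := ramp01 e1 e2 t; have /andP[? ?] := ramp01 e1 e2 (1 - t);
  rewrite mulr_ge0//= mulr_ile1.
exists (fun x : 'rV[R]_n => 1 - \prod_j r (x 0 j)); split.
- apply/smooth_onT; apply: smooth_onD; first exact: smooth_on_cst.
  apply: smooth_onN; apply: smooth_on_prod => j.
  by apply: smooth_onM; apply: smooth_ramp; smooth_tac.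
- move=> x; have : 0 <= \prod_j r (x 0 j) <= 1.
    rewrite prodr_ile1 ?andbT => [|j _]; last exact: r01.
    by apply: prodr_ge0 => j _; have /andP[] := r01 (x 0 j).
  by lra.
- move=> x [j xj]; rewrite (bigD1 j)//= (_ : r _ = 0) ?mul0r ?subr0//.
  rewrite /r; case: xj => xj.
    by rewrite ramp_le ?mul0r//; lra.
  by rewrite [X in _ * X]ramp_le ?mulr0//; lra.
- move=> x ix; rewrite big1 ?subrr// => j _.
  by have := ix j; rewrite /r => ?; rewrite !ramp_ge ?mulr1//; lra.
Qed.

(** The width is existential because the constructions that follow keep shrinking it. *)
Definition hrel n (W : diffSpace R) (f g : euclSpace R n -> W) : Prop :=
  exists2 e, 0 < e & homrel (nearbd e) f g.

Lemma hrel_trans n (W : diffSpace R) (f g h : euclSpace R n -> W) :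
  hrel f g -> hrel g h -> hrel f h.
Proof.
move=> [e e0 fg] [e' e'0 gh]; exists (Num.min e e'); first by rewrite lt_min e0.
apply: homrel_trans (homrel_sub _ fg) (homrel_sub _ gh); apply: nearbdW;
  by rewrite ge_min lexx ?orbT.
Qed.

Lemma hrel_sym n (W : diffSpace R) (f g : euclSpace R n -> W) :
  hrel f g -> hrel g f.
Proof. by move=> [e e0 /homrel_sym]; exists e. Qed.

End NearBoundary.

Lemma conv_lt (R : realFieldType) (s x y e : R) : 0 <= s <= 1 -> x < e -> y < e ->
  (1 - s) * x + s * y < e.
Proof.
move=> /andP[s0 s1] xe ye; have [xy|yx] := leP x y.
  by apply: le_lt_trans ye; have := mulr_ge0 (_ : 0 <= 1 - s) (_ : 0 <= y - x); lra.
by apply: le_lt_trans xe; have := mulr_ge0 s0 (_ : 0 <= x - y); lra.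
Qed.

Lemma conv_gt (R : realFieldType) (s x y e : R) : 0 <= s <= 1 -> e < x -> e < y ->
  e < (1 - s) * x + s * y.
Proof.
move=> s01 xe ye; rewrite -ltrN2 opprD -!mulrN; apply: conv_lt; rewrite ?ltrN2//.
Qed.

(** * N-equivalences and maps on R^n *)

Section HomotopyGroupLemmas.
Variable R : realType.
Implicit Types X Y Z W : diffSpace R.

Lemma cubemap_subproof n (phi : R -> R) (phi01 : forall t, 0 <= phi t <= 1)
  (x : euclSpace R n) : (\row_j phi ((x : 'rV[R]_n) 0 j)) \in @cube R n.
Proof. by rewrite inE => j; rewrite mxE. Qed.

Definition cubemap n (phi : R -> R) (phi01 : forall t, 0 <= phi t <= 1)
    (x : euclSpace R n) : cubeSpace R n :=
  exist _ (\row_j phi ((x : 'rV[R]_n) 0 j)) (cubemap_subproof phi01 x).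

Lemma smooth_cubemap n phi (phi01 : forall t, 0 <= phi t <= 1) :
  @smooth R (realSpace R) (realSpace R) phi -> smooth (@cubemap n phi phi01).
Proof.
move=> sphi k U q Uq.
have s : @smooth R (euclSpace R n) (euclSpace R n)
    (fun x : 'rV[R]_n => \row_j phi (x 0 j)).
  by apply/smooth_onT; smooth_tac.
exact: (s _ _ _ Uq).
Qed.

Definition bdpts n : set (cubeSpace R n) := [set t | bdcube (val t)].

Lemma bd_incl_bdpts n (t : bdcubeSpace R n) : bdpts (bd_incl t).
Proof. exact: (set_mem (valP t)). Qed.

Lemma bdptsE n (t : cubeSpace R n) : bdpts t -> exists s, t = bd_incl s.
Proof. by move=> bt; exists (exist _ (val t) (mem_set bt)); exact: val_inj. Qed.

Lemma bdpts_nearbd n (t : cubeSpace R n) e : 0 < e -> bdpts t -> nearbd e (val t).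
Proof.
by move=> e0 [_ [j [[]h]]]; exists j; rewrite h; [right|left] => /=; lra.
Qed.

Lemma pair_homotopicP n X (x0 : X) (f g : cubeSpace R n -> X) : pair_map x0 f ->
  pair_homotopic x0 f g <-> homrel (@bdpts n) f g.
Proof.
move=> [sf fx0]; rewrite homrelP; split=> -[H [sH Hf Hg Hbd]]; exists H; split=> //.
  by move=> x s /bdptsE[t ->]; rewrite Hbd fx0.
by move=> t s; rewrite Hbd ?fx0//; exact: bd_incl_bdpts.
Qed.

Lemma pair_class_eq n X (x0 : X) (f g : cubeSpace R n -> X) :
  pair_map x0 f -> pair_map x0 g ->
  pair_class x0 f = pair_class x0 g <-> homrel (@bdpts n) f g.
Proof.
move=> pf pg; split=> [fg|fg].
  have : pair_class x0 g g.
    by split=> //; apply/pair_homotopicP => //; apply: homrel_refl; case: pg.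
  by rewrite -fg => -[_ /pair_homotopicP]; exact.
apply/seteqP; split=> h [ph /pair_homotopicP H]; split=> //;
  apply/pair_homotopicP => //; apply: homrel_trans (H _) => //.
exact: homrel_sym.
Qed.

Lemma pair_map_post n X Y (x0 : X) (p : X -> Y) (f : cubeSpace R n -> X) :
  smooth p -> pair_map x0 f -> pair_map (p x0) (p \o f).
Proof.
by move=> sp [sf f0]; split; [exact: smooth_comp|move=> t; rewrite /= f0].
Qed.

Lemma pi_map_class n X Y (x0 : X) (p : X -> Y) (f : cubeSpace R n -> X) :
  smooth p -> pair_map x0 f ->
  pi_map p x0 (pair_class x0 f) = pair_class (p x0) (p \o f).
Proof.
move=> sp pf; apply/seteqP; split=> [h [g [pg /pair_homotopicP fg] gh]|h fh].
  rewrite (@pair_class_eq _ _ _ _ (p \o g) _ _).2 //; try exact: pair_map_post.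
  by apply: homrel_post => //; exact: fg.
exists f => //; split=> //; apply/pair_homotopicP => //.
by apply: homrel_refl; case: pf.
Qed.

Lemma path_connectedP X (x y : X) : path_connected x y <->
  @homrel R (euclSpace R 0) X set0 (fun=> x) (fun=> y).
Proof.
rewrite homrelP; split=> [[c [sc cx cy]]|[H [sH Hx Hy _]]].
  by exists (fun z => c z.2); split=> //; apply/smooth_onT; smooth_tac.
exists (fun t => H (0, t)); split=> //; apply/smooth_onT; smooth_tac.
Qed.

Lemma path_connected_refl X (x : X) : path_connected x x.
Proof. by apply/path_connectedP/homrel_refl/smooth_onT; smooth_tac. Qed.

Lemma path_connected_sym X (x y : X) : path_connected x y -> path_connected y x.
Proof. by move=> /path_connectedP/homrel_sym/path_connectedP. Qed.

Lemma path_connected_trans X (x y z : X) :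
  path_connected x y -> path_connected y z -> path_connected x z.
Proof.
by move=> /path_connectedP xy /path_connectedP yz; apply/path_connectedP/(homrel_trans xy).
Qed.

Lemma path_connected_post X Y (p : X -> Y) (x y : X) : smooth p ->
  path_connected x y -> path_connected (p x) (p y).
Proof.
by move=> sp /path_connectedP xy; apply/path_connectedP; exact: (homrel_post sp xy).
Qed.

Lemma pi0_map_class X Y (p : X -> Y) (x : X) : smooth p ->
  pi0_map p [set y | path_connected x y] = [set y | path_connected (p x) y].
Proof.
move=> sp; apply/seteqP; split=> [z [y xy yz]|z xz].
  by apply: path_connected_trans yz; exact: path_connected_post.
by exists x => //; exact: path_connected_refl.
Qed.

Definition stretch (t : R) : R := ramp 4^-1 (3/4) t.

(** Composition with this map turns a map of pairs on the cube into a map on R^n that is constant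
    near the boundary and outside the cube. *)
Definition squeeze n : euclSpace R n -> cubeSpace R n :=
  @cubemap n stretch (ramp01 _ _).

Lemma smooth_squeeze n : smooth (@squeeze n).
Proof. by apply: smooth_cubemap; apply/smooth_onT/smooth_ramp; smooth_tac. Qed.

Lemma squeeze_bdpts n (x : euclSpace R n) : nearbd 4^-1 x -> bdpts (squeeze x).
Proof.
move=> [j xj]; split; first exact: (set_mem (valP (squeeze x))).
exists j; case: xj => xj; [exists false|exists true]; rewrite mxE.
  by rewrite /stretch ramp_le//; lra.
by rewrite /stretch ramp_ge//; lra.
Qed.

(** The straight-line homotopy from the identity to [squeeze] preserves a neighbourhood of the
    boundary: a coordinate below 1/4 moves towards 0 and one above 3/4 towards 1. *)
Lemma hrel_squeeze n W (c : euclSpace R n -> W) w0 e : smooth c -> 0 < e ->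
  (forall x, nearbd e x -> c x = w0) -> hrel c (fun x => c (val (squeeze x))).
Proof.
move=> sc e0 cw; exists (Num.min e 4^-1); first by rewrite lt_min e0; lra.
have sq := @smooth_squeeze n.
apply: (@homrel_of _ _ _ _ (fun z : prodSpace (euclSpace R n) (realSpace R) =>
    c (\row_j ((1 - (z.2 : R)) * (z.1 : 'rV[R]_n) 0 j
              + (z.2 : R) * (val (squeeze z.1) : 'rV[R]_n) 0 j)))).
- have sv := @smooth_val R (euclSpace R n) (@cube R n).
  by apply/smooth_onT; smooth_tac.
- by move=> x; congr c; apply/rowP => j; rewrite mxE/=; ring.
- by move=> x; congr c; apply/rowP => j; rewrite mxE/=; ring.
- have m1 : Num.min e 4^-1 <= e by rewrite ge_min lexx.
  have m2 : Num.min e 4^-1 <= 4^-1 by rewrite ge_min lexx orbT.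
  move=> x s xm /andP[s0 s1]; rewrite !cw//=; first exact: nearbdW m1 _ xm.
  have [j xj] := xm; exists j; rewrite !mxE/=.
  case: xj => xj; [left|right].
    by apply: conv_lt; rewrite ?s0 ?s1 /stretch ?ramp_le//; lra.
  by apply: conv_gt; rewrite ?s0 ?s1 /stretch ?ramp_ge//; lra.
Qed.

Section Equivalence.
Variables (N : nat) (Y Z : diffSpace R) (p : Y -> Z).
Hypothesis hp : N_equivalence N p.

Let sp : smooth p. Proof. by case: hp. Qed.

Lemma pi0_surj (z : Z) : exists y, path_connected (p y) z.
Proof.
have [_ [_ surj] _] := hp.
have zz : pi0 Z [set z' | path_connected z z'] by exists z.
have [_ [y ->]] := surj _ zz; rewrite pi0_map_class// => pyz.
exists y; have : [set z' | path_connected z z'] z by exact: path_connected_refl.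
by rewrite -pyz.
Qed.

(** In positive degree, [a] and the constant map are compared as classes on the cube, and the
    homotopy so obtained is carried back to R^m by [squeeze]. *)
Lemma pi_inj m (y0 : Y) (a : euclSpace R m -> Y) e : (m < N)%N -> smooth a ->
  0 < e -> (forall x, nearbd e x -> a x = y0) ->
  hrel (fun=> p y0) (p \o a) -> hrel (fun=> y0) a.
Proof.
case: m a => [|m] a mN sa e0 ay0 [e' e'0 pa].
  (* In degree 0 the domain is a point without boundary, and the statement is the injectivity on
     path components. *)
  have a0 x : a x = a 0 by congr a; exact: thinmx0.
  have pc : path_connected (p y0) (p (a 0)).
    apply/path_connectedP; apply: (homrel_sub (D := nearbd e')) => //.
    by apply: homrel_ext pa => // x /=; rewrite a0.
  exists 1 => //; have [_ [/(_ mN) inj _] _] := hp.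
  have : [set y | path_connected y0 y] = [set y | path_connected (a 0) y].
    apply: inj; [by rewrite inE; exists y0|by rewrite inE; exists (a 0)|].
    rewrite !pi0_map_class//; apply/seteqP; split=> z; apply: path_connected_trans => //.
    exact: path_connected_sym.
  move=> E; have : [set y | path_connected (a 0) y] (a 0) by exact: path_connected_refl.
  rewrite -E => /path_connectedP H.
  apply: (@homrel_sub _ _ _ set0); first by move=> x [[]].
  by apply: homrel_ext H => // x; rewrite a0.
have [_ _ /(_ y0 m.+1 isT)[/(_ mN) inj _]] := hp.
have pf : pair_map y0 (a \o val : cubeSpace R m.+1 -> Y).
  split; first exact: (smooth_comp sa (@smooth_val R _ _)).
  by move=> t; exact: ay0 (bdpts_nearbd e0 (bd_incl_bdpts t)).
have pg : pair_map y0 (fun _ : cubeSpace R m.+1 => y0).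
  by split=> //; apply/smooth_onT; smooth_tac.
have : homrel (@bdpts m.+1) (fun=> y0) (a \o val).
  apply/(pair_class_eq pg pf); apply: inj; rewrite ?inE.
  - by exists (fun=> y0).
  - by eexists; [exact: pf|].
  rewrite !pi_map_class//; apply/pair_class_eq; try exact: pair_map_post.
  exact: (homrel_pre (@smooth_val R _ _) (fun t => @bdpts_nearbd _ t _ e'0) pa).
move=> ha; apply: hrel_trans (hrel_sym (hrel_squeeze sa e0 ay0)).
exists 4^-1; first lra.
exact: (homrel_pre (@smooth_squeeze _) (@squeeze_bdpts _) ha).
Qed.

(** The restriction of [d] to the cube is a class of Z at [p y0]; a representative of a preimage of
    this class, composed with [squeeze], is the lift. *)
Lemma pi_surj n (y0 : Y) (d : euclSpace R n -> Z) e : (0 < n <= N)%N ->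
  smooth d -> 0 < e -> (forall x, nearbd e x -> d x = p y0) ->
  exists y : euclSpace R n -> Y, exists e',
    [/\ smooth y, 0 < e', forall x, nearbd e' x -> y x = y0 & hrel d (p \o y)].
Proof.
move=> /andP[n0 nN] sd e0 dy0.
have [_ _ /(_ y0 n n0)[_ /(_ nN) surj]] := hp.
have pf : pair_map (p y0) (d \o val : cubeSpace R n -> Z).
  split; first exact: (smooth_comp sd (@smooth_val R _ _)).
  by move=> t; exact: dy0 (bdpts_nearbd e0 (bd_incl_bdpts t)).
have /surj[_ [k pk ->]] : pi_n n (p y0) (pair_class (p y0) (d \o val)).
  by exists (d \o val).
rewrite pi_map_class// => /pair_class_eq.
move=> /(_ (pair_map_post sp pk) pf)/homrel_sym dk.
exists (k \o @squeeze n), 4^-1; split.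
- by apply: smooth_comp; [case: pk|exact: smooth_squeeze].
- lra.
- by move=> x /squeeze_bdpts/bdptsE[s E]; case: pk => _ k0; rewrite /= E k0.
- apply: (hrel_trans (hrel_squeeze sd e0 dy0)); exists 4^-1; first lra.
  exact: (homrel_pre (@smooth_squeeze _) (@squeeze_bdpts _) dk).
Qed.

End Equivalence.

End HomotopyGroupLemmas.

(** * The compression lemma *)

Section LastCoordinate.
Variable R : realType.
Implicit Types (X : diffSpace R) (m : nat) (e t : R).

Definition hd m (x : 'rV[R]_m.+1) : R := x 0 ord0.
Definition tl m (x : 'rV[R]_m.+1) : 'rV[R]_m := \row_j x 0 (lift ord0 j).
Definition cns m (t : R) (y : 'rV[R]_m) : 'rV[R]_m.+1 :=
  \row_j (if unlift ord0 j is Some i then y 0 i else t).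

Lemma hd_cns m t (y : 'rV[R]_m) : hd (cns t y) = t.
Proof. by rewrite /hd mxE unlift_none. Qed.

Lemma tl_cns m t (y : 'rV[R]_m) : tl (cns t y) = y.
Proof. by apply/rowP => j; rewrite !mxE liftK. Qed.

Lemma cns_eta m (x : 'rV[R]_m.+1) : cns (hd x) (tl x) = x.
Proof. by apply/rowP => j; rewrite !mxE; case: unliftP => [i|] ->; rewrite ?mxE. Qed.

Lemma smooth_hd m : @smooth R (euclSpace R m.+1) (realSpace R) (@hd m).
Proof. exact: smooth_coord. Qed.

Lemma smooth_on_hd m X (A : set X) (f : X -> 'rV[R]_m.+1) :
  @smooth_on R X (euclSpace R m.+1) A f ->
  @smooth_on R X (realSpace R) A (fun x => hd (f x)).
Proof. by move=> sf; rewrite /hd; smooth_tac. Qed.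

Lemma smooth_on_tl m X (A : set X) (f : X -> 'rV[R]_m.+1) :
  @smooth_on R X (euclSpace R m.+1) A f ->
  @smooth_on R X (euclSpace R m) A (fun x => tl (f x)).
Proof. by move=> sf; rewrite /tl; smooth_tac. Qed.

Lemma smooth_on_cns m X (A : set X) (f : X -> R) (g : X -> 'rV[R]_m) :
  @smooth_on R X (realSpace R) A f -> @smooth_on R X (euclSpace R m) A g ->
  @smooth_on R X (euclSpace R m.+1) A (fun x => cns (f x) (g x)).
Proof.
move=> sf sg; rewrite /cns; apply: smooth_on_row => j /=.
by case: (unlift ord0 j) => [i|]; smooth_tac.
Qed.

(** With [hd x = 1] as the top face, this is a neighbourhood of the union of all the other faces. *)
Definition side m e : set (euclSpace R m.+1) :=
  [set x : 'rV[R]_m.+1 | hd x < e \/ nearbd e (tl x)].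

Lemma nearbdS m e (x : euclSpace R m.+1) :
  nearbd e x <-> side e x \/ 1 - e < hd x.
Proof.
split=> [[j]|[[h|[j h]]|h]]; last 3 first.
- by exists ord0; left.
- by exists (lift ord0 j); move: h; rewrite !mxE.
- by exists ord0; right.
case: (unliftP ord0 j) => [i ->|-> []h]; last 2 first.
- by left; left.
- by right.
by move=> h; left; right; exists i; rewrite !mxE.
Qed.

Lemma sideW m e e' : e <= e' -> @side m e `<=` side e'.
Proof. by move=> ee x [h|/(nearbdW ee) h]; [left; lra|right]. Qed.

Lemma side_nearbd m e : @side m e `<=` nearbd e.
Proof. by move=> x h; apply/nearbdS; left. Qed.

Lemma side_cns m e t (y : euclSpace R m) : side e (cns t y) <-> t < e \/ nearbd e y.
Proof. by rewrite /side/= hd_cns tl_cns. Qed.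

Lemma top_cns m e t (y : euclSpace R m) : 1 - e < t -> nearbd e (cns t y).
Proof. by move=> te; apply/nearbdS; right; rewrite hd_cns. Qed.

(** A map of the line into the region above 1 - e that is the identity near 1. Applied to the
    coordinate [hd], it extends data given only near the top face downwards, without changing them
    close to that face. *)
Definition ease e (t : R) : R := 1 + (t - 1) * ramp (1 - e / 2) (1 - e / 4) t.

Lemma ease1 e t : 0 < e -> t <= 1 - e / 2 -> ease e t = 1.
Proof. by move=> e0 te; rewrite /ease ramp_le ?mulr0 ?addr0//; lra. Qed.

Lemma ease_id e t : 0 < e -> 1 - e / 4 <= t -> ease e t = t.
Proof. by move=> e0 te; rewrite /ease ramp_ge ?mulr1; lra. Qed.

Lemma ease_gt e t : 0 < e -> 1 - e < ease e t.
Proof.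
move=> e0; have [te|te] := leP t (1 - e / 2); first by rewrite ease1//; lra.
rewrite /ease; have := ramp01 (1 - e / 2) (1 - e / 4) t; set r := ramp _ _ _ => r01.
have : 1 - e < (1 - r) * 1 + r * t by apply: conv_gt => //; lra.
by lra.
Qed.

Lemma smooth_ease X (A : set X) e (f : X -> R) :
  @smooth_on R X (realSpace R) A f ->
  @smooth_on R X (realSpace R) A (fun x => ease e (f x)).
Proof. move=> sf; rewrite /ease; apply: smooth_onD; first by smooth_tac.
by apply: smooth_onM; [smooth_tac|exact: smooth_ramp]. Qed.

Lemma dopen_hd_lt m (a : R) : @dopen R (euclSpace R m.+1) [set x | hd x < a].
Proof. by apply: dopen_lt; [exact: smooth_hd|exact: smooth_cstR]. Qed.

Lemma dopen_hd_gt m (a : R) : @dopen R (euclSpace R m.+1) [set x | a < hd x].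
Proof. by apply: dopen_lt; [exact: smooth_cstR|exact: smooth_hd]. Qed.

End LastCoordinate.

Ltac csmooth := repeat first
  [ apply: smooth_on_hd | apply: smooth_on_tl | apply: smooth_on_cns
  | apply: smooth_ramp | apply: smooth_ease | progress smooth_step ].

(** * Concatenation in the first coordinate *)

Section Stack.
Variables (R : realType) (m : nat) (W : diffSpace R).
Implicit Types (e t : R) (u v c E : euclSpace R m.+1 -> W).

Definition fold1 (t : R) : R := ramp (1/6) (1/3) t.
(** Unlike a rescaling this is the identity from 5/6 on, so that [stack u v] is literally [v] near
    the top face. *)
Definition fold2 (t : R) : R := t * ramp (2/3) (5/6) t.

(* With the coordinate [hd] as time, [stack u v] is [u] followed by [v] and
   [doubling u v] is [u] followed by the reverse of [v]. *)
Definition stack u v (x : euclSpace R m.+1) : W :=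
  if `[< hd x < 2/3 >] then u (cns (3 * hd x) (tl x))
  else v (cns (fold2 (hd x)) (tl x)).

Definition doubling u v (x : euclSpace R m.+1) : W :=
  if `[< hd x < 2/3 >] then u (cns (fold1 (hd x)) (tl x))
  else v (cns (fold1 (1 - hd x)) (tl x)).

Lemma smooth_stack u v w e : smooth u -> smooth v -> 0 < e ->
  (forall x, nearbd e x -> u x = w) -> (forall x, side e x -> v x = w) ->
  smooth (stack u v).
Proof.
move=> su sv e0 uw vw.
apply: (@smooth_patch _ (euclSpace R m.+1) W [set x : 'rV_m.+1 | hd x < 2/3]
  [set x : 'rV_m.+1 | 1/3 < hd x]); [exact: dopen_hd_lt|exact: dopen_hd_gt|..].
- by move=> x /=; case: (ltP (hd x) (2/3)) => ?; [left|right; lra].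
- by csmooth.
- by rewrite /fold2; csmooth.
(* On the overlap [3 * hd x] exceeds 1, so [u] is beyond its top face, while [fold2] is 0, so [v] is
   on its bottom face; both give [w]. *)
- move=> x /= x1 x2; rewrite uw ?vw//.
    by apply/side_cns; left; rewrite /fold2 ramp_le ?mulr0//; lra.
  by apply: top_cns; lra.
Qed.

Lemma stack_side u v w e x : 0 < e ->
  (forall x, nearbd e x -> u x = w) -> (forall x, side e x -> v x = w) ->
  side (Num.min (e / 3) (1/3)) x -> stack u v x = w.
Proof.
move=> e0 uw vw xe.
(* The bound e/3 absorbs the factor 3 in [stack]; the bound 1/3 keeps a small [hd x] out of the
   upper branch. *)
have m1 : Num.min (e / 3) (1 / 3) <= e / 3 by rewrite ge_min lexx.
have m2 : Num.min (e / 3) (1 / 3) <= 1 / 3 by rewrite ge_min lexx orbT.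
rewrite /stack; case: asboolP => h; [apply: uw|apply: vw].
  apply: side_nearbd; apply/side_cns; case: xe => xe; [left; lra|right].
  by apply: nearbdW xe; lra.
apply/side_cns; case: xe => xe; [lra|right].
by apply: nearbdW xe; lra.
Qed.

Lemma stack_top u v x : 5/6 <= hd x -> stack u v x = v x.
Proof.
move=> h; rewrite /stack asboolF /fold2 ?ramp_ge ?mulr1 ?cns_eta//; lra.
Qed.

Lemma hrel_stack u u' v w e : smooth u -> smooth v -> 0 < e ->
  (forall x, nearbd e x -> u x = w) -> (forall x, side e x -> v x = w) ->
  hrel u u' -> hrel (stack u v) (stack u' v).
Proof.
move=> su sv e0 uw vw [e' e'0 [K [sK Ku Ku' KD]]].
pose e2 := Num.min e e'.
have m1 : e2 <= e by rewrite ge_min lexx.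
have m2 : e2 <= e' by rewrite ge_min lexx orbT.
have e20 : 0 < e2 by rewrite lt_min e0.
have Kw x (s : R) : nearbd e2 x -> K (x, s) = w.
  by move=> xe; rewrite KD ?uw//; [exact: nearbdW m1 _ xe|exact: nearbdW m2 _ xe].
exists (Num.min (e2 / 3) (1/3)); first by rewrite lt_min; apply/andP; split; lra.
have m3 : Num.min (e2 / 3) (1 / 3) <= e2 / 3 by rewrite ge_min lexx.
have m4 : Num.min (e2 / 3) (1 / 3) <= 1 / 3 by rewrite ge_min lexx orbT.
pose A := [set z : prodSpace (euclSpace R m.+1) (realSpace R) | hd z.1 < 2/3].
exists (fun z => if `[< A z >] then K (cns (3 * hd z.1) (tl z.1), z.2)
  else v (cns (fold2 (hd z.1)) (tl z.1))); split.
- apply: (@smooth_patch _ _ _ A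
    [set z : prodSpace (euclSpace R m.+1) (realSpace R) | 1/3 < hd z.1]).
  + by apply: dopen_preimage (@dopen_hd_lt R m _); exact: smooth_fst.
  + by apply: dopen_preimage (@dopen_hd_gt R m _); exact: smooth_fst.
  + by move=> z; rewrite /A/=; case: (ltP (hd z.1) (2/3)) => ?; [left|right; lra].
  + by csmooth.
  + by rewrite /fold2; csmooth.
  + move=> [x s] /= x1 x2; rewrite Kw ?vw//.
      by apply/side_cns; left; rewrite /fold2 ramp_le ?mulr0//; rewrite /A/= in x1; lra.
    by apply: top_cns; lra.
- by move=> x s s0; rewrite /stack /A/= Ku.
- by move=> x s s0; rewrite /stack /A/= Ku'.
- move=> x s xe; rewrite /stack /A/=; case: asboolP => // h.
  have n2 : nearbd e2 (cns (3 * hd x) (tl x)).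
    move: xe => /nearbdS [[xe|xe]|xe].
    + by apply/nearbdS; left; apply/side_cns; left; lra.
    + by apply/nearbdS; left; apply/side_cns; right; apply: nearbdW xe; lra.
    + by lra.
  by rewrite Kw// uw//; exact: nearbdW m1 _ n2.
Qed.

Lemma smooth_doubling c v e : smooth c -> smooth v -> 0 < e ->
  (forall x, nearbd e x -> c x = v x) -> smooth (doubling c v).
Proof.
move=> sc sv e0 cv.
apply: (@smooth_patch _ (euclSpace R m.+1) W [set x : 'rV_m.+1 | hd x < 2/3]
  [set x : 'rV_m.+1 | 1/3 < hd x]); [exact: dopen_hd_lt|exact: dopen_hd_gt|..].
- by move=> x /=; case: (ltP (hd x) (2/3)) => ?; [left|right; lra].
- by rewrite /fold1; csmooth.
- by rewrite /fold1; csmooth.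
- move=> x /= x1 x2; rewrite /fold1 !ramp_ge; [|lra..].
  by apply: cv; apply: top_cns; lra.
Qed.

(** The top faces of [c] and [v] meet in the middle, and both ends in the direction [hd] are now
    bottom faces, where the value is [w]. The result is constant near the whole boundary, so it
    defines a class in a homotopy group. *)
Lemma doubling_nearbd c v w e x : 0 < e -> e <= 20^-1 ->
  (forall x, side e x -> c x = w) -> (forall x, side e x -> v x = w) ->
  nearbd e x -> doubling c v x = w.
Proof.
move=> e0 e1 cw vw.
move=> /nearbdS[[xe|xe]|xe].
- rewrite /doubling asboolT; last lra.
  by apply: cw; apply/side_cns; left; rewrite /fold1 ramp_le//; lra.
- by rewrite /doubling; case: asboolP => _; [apply: cw|apply: vw]; apply/side_cns; right.
- rewrite /doubling asboolF; last lra.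
  by apply: vw; apply/side_cns; left; rewrite /fold1 ramp_le//; lra.
Qed.

(* In the direction [hd] the left side runs through [c], then back and forth
   through [E]; the excursion in [E] is contracted onto the region near
   the top face, where [E] and [c] agree. *)
Lemma hrel_doubling c E w e : smooth c -> smooth E -> 0 < e -> e <= 20^-1 ->
  (forall x, nearbd e x -> c x = E x) -> (forall x, side e x -> c x = w) ->
  hrel (stack (doubling c E) E) c.
Proof.
move=> sc sE e0 e1 cE cw.
have Ew x : side e x -> E x = w.
  by move=> xe; rewrite -cE ?cw//; exact: side_nearbd.
have ee : 0 < e / 4 by lra.
have sideW x : nearbd (e / 4) x -> 1 - e / 4 < hd x \/ side e x /\ side (e/4) x.
  by move=> /nearbdS[h|h]; [right; split=> //; apply: sideW h; lra|left].
(* The first factor [c] ends at 2/9: [stack] multiplies the coordinate by 3 and [doubling] changes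
   branch at 2/3. *)
pose A := [set x : euclSpace R m.+1 | hd x < 2/9].
pose mid r x := if `[< A x >] then c (cns (fold1 (3 * hd x)) (tl x))
  else E (cns (r (hd x)) (tl x)).
(* The reversed [E] and the second [E] are never traversed at the same time: at each [t] one of the
   two terms is 0, so one formula in [E] covers both. *)
pose F t := fold1 (1 - 3 * t) + fold2 t.
have -> : stack (doubling c E) E = mid F.
  apply/funext => x; rewrite /stack /doubling /mid /A /F /=.
  rewrite hd_cns tl_cns; case: asboolP => h1; last first.
    rewrite asboolF; last lra.
    by rewrite {1}/fold1 ramp_le ?add0r//; lra.
  case: asboolP => h2; first by rewrite asboolT//; lra.
  rewrite asboolF; last lra.
  by rewrite [fold2 _]/fold2 ramp_le ?mulr0 ?addr0//; lra.
have Fone t : 1/9 < t -> t < 2/9 -> F t = 1.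
  by move=> t1 t2; rewrite /F /fold1 /fold2 ramp_ge ?ramp_le; lra.
have f1one t : 1/9 < t -> fold1 (3 * t) = 1.
  by move=> t1; rewrite /fold1 ramp_ge//; lra.
apply: (@hrel_trans _ _ _ _ (mid (ease e))).
  exists (e / 4) => //.
  apply: (@homrel_of _ _ _ _ (fun z : prodSpace (euclSpace R m.+1) (realSpace R) =>
     mid (fun t => (1 - (z.2 : R)) * F t + (z.2 : R) * ease e t) z.1)).
  - apply: (@smooth_patch _ _ _
      [set z : prodSpace (euclSpace R m.+1) (realSpace R) | hd z.1 < 2/9]
      [set z : prodSpace (euclSpace R m.+1) (realSpace R) | 1/9 < hd z.1]
      (fun z => c (cns (fold1 (3 * hd z.1)) (tl z.1)))
      (fun z => E (cns ((1 - (z.2 : R)) * F (hd z.1)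
                        + (z.2 : R) * ease e (hd z.1)) (tl z.1)))).
    + by apply: dopen_preimage (@dopen_hd_lt R m _); exact: smooth_fst.
    + by apply: dopen_preimage (@dopen_hd_gt R m _); exact: smooth_fst.
    + by move=> z /=; case: (ltP (hd z.1) (2/9)) => ?; [left|right; lra].
    + by rewrite /fold1; csmooth.
    + by rewrite /F /fold1 /fold2; csmooth.
    + move=> z /= z1 z2; rewrite f1one// Fone// (ease1 e0); last lra.
      by rewrite cE; [congr (E (cns _ _)); ring|apply: top_cns; lra].
  - by move=> x; rewrite /mid/=; case: asboolP => // _; congr (E (cns _ _)); ring.
  - by move=> x; rewrite /mid/=; case: asboolP => // _; congr (E (cns _ _)); ring.
  - move=> x s /sideW xe _ /=; rewrite /mid; case: asboolP => // xA.
    move/negP: xA; rewrite -leNgt => xA.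
    have [x1|[[h|h] _]] := xe; [|by exfalso; lra|by rewrite !Ew//; apply/side_cns; right].
    rewrite (ease_id e0); last lra.
    have -> : F (hd x) = hd x.
      by rewrite /F /fold1 /fold2 ramp_le ?ramp_ge; lra.
    by congr (E (cns _ _)); ring.
(* After the move to [ease e], the second branch reads [E] only near the top face, where it equals
   [c]; the whole map is a reparametrisation of [c]. *)
have -> : mid (ease e) = fun x => c (cns (fold1 (3 * hd x) * ease e (hd x)) (tl x)).
  apply/funext => x; rewrite /mid /A/=; case: asboolP => xA.
    by rewrite (ease1 e0) ?mulr1//; lra.
  by rewrite f1one ?mul1r -?cE//; [apply: top_cns; exact: ease_gt|lra].
exists (e / 4) => //.
apply: (@homrel_of _ _ _ _ (fun z : prodSpace (euclSpace R m.+1) (realSpace R) =>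
   c (cns ((1 - (z.2 : R)) * (fold1 (3 * hd z.1) * ease e (hd z.1)) + (z.2 : R) * hd z.1)
   (tl z.1)))).
- by apply/smooth_onT; rewrite /fold1; csmooth.
- by move=> x /=; congr (c (cns _ _)); ring.
- by move=> x /=; rewrite -[in RHS](cns_eta x); congr (c (cns _ _)); ring.
- move=> x s /sideW xe s01 /=.
  have [x1|[_ [h|h]]] := xe.
  + rewrite (ease_id e0) ?f1one; [|lra..].
    by congr (c (cns _ _)); ring.
  + rewrite [fold1 _]/fold1 ramp_le ?mul0r; [|lra..].
    rewrite !cw//; apply/side_cns; left => //.
    by apply: conv_lt => //; lra.
  + by rewrite !cw//; apply/side_cns; right; apply: nearbdW h; lra.
Qed.

End Stack.

(** * Data constant on all faces but the top one *)

Section CompressionLemma.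
Variable R : realType.

Lemma ex_common_lower (a b : R) : 0 < a -> 0 < b ->
  exists c, [/\ 0 < c, c <= a & c <= b].
Proof.
by move=> a0 b0; exists (Num.min a b); rewrite lt_min a0 b0 !ge_min !lexx orbT.
Qed.

Lemma compress_straight N (Y Z : diffSpace R) (p : Y -> Z) m
    (a : euclSpace R m.+1 -> Y) (c : euclSpace R m.+1 -> Z) (y0 : Y) (e : R) :
  N_equivalence N p -> (m < N)%N -> 0 < e -> e <= 20^-1 ->
  smooth_on (nearbd e) a -> smooth c ->
  (forall x, nearbd e x -> c x = p (a x)) -> (forall x, side e x -> a x = y0) ->
  exists (h : euclSpace R m.+1 -> Y) (e' : R), [/\ smooth h, 0 < e',
    forall x, nearbd e' x -> h x = a x & hrel c (p \o h)].
Proof.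
move=> hp mN e0 e1 sa sc ca ay0.
have sp : smooth p by case: hp.
pose alpha (y : euclSpace R m) : Y := a (cns 1 y).
have s_alpha : smooth alpha.
  apply/smooth_onT; apply: (smooth_on_comp sa); first by csmooth.
  by move=> y _; apply: top_cns; lra.
have alpha0 y : nearbd e y -> alpha y = y0 by move=> ye; apply: ay0; apply/side_cns; right.
have cside x : side e x -> c x = p y0 by move=> xe; rewrite ca ?ay0//; exact: side_nearbd.
(* Read with the first coordinate as time, [c] itself is a null-homotopy of [p \o alpha]. *)
have /(pi_inj hp mN s_alpha e0 alpha0)[ek ek0 [k [sk ky0 ka kD]]] :
    hrel (fun=> p y0) (p \o alpha).
  exists e => //; apply: (@homrel_of _ _ _ _
    (fun z : prodSpace (euclSpace R m) (realSpace R) => c (cns z.2 z.1))).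
  - by apply/smooth_onT; csmooth.
  - by move=> y /=; apply: cside; apply/side_cns; left.
  - by move=> y /=; apply: ca; apply: top_cns; lra.
  - by move=> y s ye _ /=; apply: cside; apply/side_cns; right.
pose T := [set x : euclSpace R m.+1 | 1 - e < hd x].
(* The null-homotopy [k] runs while [hd x] goes from 1/4 to 3/4. Above 3/4 it stays at [alpha],
   which is also the value of [a] along [ease e] as long as [ease e] is 1; the two branches meet
   there. *)
pose h0 x := if `[< T x >] then a (cns (ease e (hd x)) (tl x))
  else k (tl x, (hd x - 1/4) * 2).
have sh0 : smooth h0.
  apply: (@smooth_patch _ _ _ T [set x : euclSpace R m.+1 | hd x < 1 - e / 2]).
  - exact: dopen_hd_gt.
  - exact: dopen_hd_lt.
  - by move=> x; rewrite /T/=; case: (ltP (1 - e) (hd x)) => ?; [left|right; lra].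
  - apply: (smooth_on_comp sa); first by csmooth.
    by move=> x _; apply: top_cns; exact: ease_gt.
  - by csmooth.
  - rewrite /T => x /= x1 x2; rewrite ease1; [|lra..].
    by rewrite ka//; lra.
have e40 : 0 < e / 4 by lra.
have [e4 [e4p e4k e4e]] := ex_common_lower ek0 e40.
have h0side x : side e4 x -> h0 x = y0.
  move=> xe; rewrite /h0; case: asboolP => xT.
    rewrite /T/= in xT; case: xe => xe; first by exfalso; lra.
    by apply: ay0; apply/side_cns; right; apply: nearbdW xe; lra.
  case: xe => xe; first by rewrite ky0//; lra.
  by rewrite kD//; exact: nearbdW e4k _ xe.
have h0top x : 1 - e / 4 <= hd x -> h0 x = a x.
  by move=> xe; rewrite /h0 asboolT ?ease_id ?cns_eta// /T/=; lra.
have h0a x : nearbd e4 x -> h0 x = a x.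
  move=> /nearbdS[xe|xe]; last by apply: h0top; lra.
  by rewrite h0side// ay0//; apply: sideW xe; lra.
have cE x : nearbd e4 x -> c x = (p \o h0) x.
  by move=> xe; rewrite /= h0a// ca//; apply: nearbdW xe; lra.
have cside4 x : side e4 x -> c x = p y0 by move=> xe; apply: cside; apply: sideW xe; lra.
have Eside x : side e4 x -> (p \o h0) x = p y0 by move=> xe; rewrite /= h0side.
have sE : smooth (p \o h0) by exact: smooth_comp.
have e4s : e4 <= 20^-1 by lra.
(* The difference class of [c] and [p \o h0]. *)
pose d := doubling c (p \o h0).
have sd : smooth d by exact: smooth_doubling cE.
have dw x : nearbd e4 x -> d x = p y0 by apply: doubling_nearbd.
have [y [ey [sy ey0 yw dy]]] := @pi_surj _ _ _ _ _ hp m.+1 y0 d e4 mN sd e4p dw.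
have [e5 [e5p e5y e54]] := ex_common_lower ey0 e4p.
have yw5 x : nearbd e5 x -> y x = y0 by move=> xe; apply: yw; exact: nearbdW xe.
have h0w5 x : side e5 x -> h0 x = y0 by move=> xe; apply: h0side; exact: sideW xe.
have e53 : 0 < e5 / 3 by lra.
have [e6 [e6p e65 e66]] : exists e6 : R, [/\ 0 < e6, e6 <= e5 / 3 & e6 <= 6^-1].
  by apply: ex_common_lower => //; lra.
exists (stack y h0), e6; split=> //.
- exact: smooth_stack yw5 h0w5.
- move=> x /nearbdS[xe|xe].
    rewrite (stack_side e5p yw5 h0w5); last first.
      by apply: sideW xe; rewrite le_min; apply/andP; split; lra.
    by rewrite ay0//; apply: sideW xe; lra.
  by rewrite stack_top; [apply: h0top|]; lra.
- have -> : p \o stack y h0 = stack (p \o y) (p \o h0).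
    by apply/funext => x; rewrite /stack /=; case: asboolP.
  (* [c] is homotopic to its difference from [p \o h0] followed by [p \o h0]; the lift [y] of the
     difference then replaces it. *)
  apply: hrel_trans (hrel_sym (hrel_doubling sc sE e4p e4s cE cside4)) _.
  exact: hrel_stack dw Eside dy.
Qed.

End CompressionLemma.

(** * Reduction of general boundary data to the preceding case *)

Section CompressionLemma.
Variable R : realType.

(* [r] first pushes the distinguished coordinate to 0, then contracts the bottom face;
   slowing the time down to 0 away from [side e] keeps the top face in place. *)
Lemma ex_collapse m (e : R) : 0 < e ->
  exists q : prodSpace (euclSpace R m.+1) (realSpace R) -> euclSpace R m.+1,
    [/\ smooth q, forall x, q (x, 0) = x,
        forall x (s : R), nearbd e x -> nearbd e (q (x, s)),
        forall x, side (e / 4) x -> q (x, 1) = cns 0 0 & side e (cns 0 0 : euclSpace R m.+1)].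
Proof.
move=> e0.
have e42 : e / 4 < e / 2 by lra.
have [b [sb b01 b1 b0]] := ex_bump m e42.
pose w (x : euclSpace R m.+1) := 1 - (1 - b (tl x)) * ramp (e / 4) (e / 2) (hd x).
pose r (z : prodSpace (euclSpace R m.+1) (realSpace R)) : euclSpace R m.+1 :=
  cns (hd z.1 * (1 - sstep (2 * (z.2 : R))))
      (\row_j ((1 - sstep (2 * (z.2 : R) - 1)) * tl z.1 0 j)).
have rside x s : side e x -> side e (r (x, s)).
  move=> xe; apply/side_cns => /=.
  have [s1|s1] := leP (2 * s - 1) 0; last by left; rewrite sstep_ge1; lra.
  have -> : \row_j ((1 - sstep (2 * s - 1)) * tl x 0 j) = tl x.
    by apply/rowP => j; rewrite !mxE sstep_le0 // subr0 mul1r.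
  case: xe => xe; [left|by right].
  have := conv_lt (sstep01 (2 * s)) xe e0; lra.
exists (fun z => r (z.1, (z.2 : R) * w z.1)); split.
- by rewrite /r /w; apply/smooth_onT; csmooth.
- move=> x; rewrite /r /= mul0r mulr0 !sstep_le0; [|lra..].
  rewrite !subr0 mulr1 -[RHS]cns_eta; congr cns.
  by apply/rowP => j; rewrite mxE mul1r.
- move=> x s xe /=; have [xs|xs] := pselect (side e x).
    by apply: side_nearbd; exact: rside.
  have -> : w x = 0.
    rewrite /w b0 ?ramp_ge; [lra|lra| |].
      by rewrite leNgt; apply/negP => h; apply: xs; left; lra.
    by apply: (@notin_nearbd _ _ e); [lra|move=> h; apply: xs; right].
  rewrite mulr0 /r /= mulr0 !sstep_le0; [|lra..].
  rewrite !subr0 mulr1 [X in cns _ X](_ : _ = tl x) ?cns_eta//.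
  by apply/rowP => j; rewrite mxE mul1r.
- move=> x xe /=; have -> : w x = 1.
    by rewrite /w; case: xe => xe; [rewrite ramp_le; lra|rewrite b1//; lra].
  rewrite /r /= !sstep_ge1; [|lra..].
  rewrite subrr mulr0; congr cns.
  by apply/rowP => j; rewrite !mxE mul0r.
- by apply/side_cns; left.
Qed.

(** The collapse [q] deforms [a] and [c] together, because it preserves the region where [a] is
    defined. The collapsed problem has a solution [h']; in a collar the collapse is run backwards
    towards the boundary, which joins [h'] to the original [a]. *)
Lemma compress N (Y Z : diffSpace R) (p : Y -> Z) n
    (a : euclSpace R n -> Y) (c : euclSpace R n -> Z) (e : R) :
  N_equivalence N p -> (n <= N)%N -> 0 < e ->
  smooth_on (nearbd e) a -> smooth c -> (forall x, nearbd e x -> c x = p (a x)) ->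
  exists (h : euclSpace R n -> Y) (e' : R), [/\ smooth h, 0 < e',
    forall x, nearbd e' x -> h x = a x & hrel c (p \o h)].
Proof.
move=> hp nN; have sp : smooth p by case: hp.
case: n nN a c => [|m] mN a c e0 sa sc ca.
  (* In dimension 0 there is no boundary, and surjectivity on path components suffices. *)
  have [y /path_connected_sym/path_connectedP yc] := pi0_surj hp (c 0).
  exists (fun=> y), 1; split=> //; first by apply/smooth_onT; smooth_tac.
    by move=> x [[]].
  exists 1 => //; apply: (@homrel_sub _ _ _ set0); first by move=> x [[]].
  by apply: homrel_ext yc => // x; congr c; rewrite [x]thinmx0.
wlog e1 : e e0 sa ca / e <= 20^-1.
  move=> H; have [e2 [e20 e2e e21]] : exists e2 : R, [/\ 0 < e2, e2 <= e & e2 <= 20^-1].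
    by apply: ex_common_lower => //; lra.
  apply: (H e2) => //; first by apply: smooth_on_sub sa; exact: nearbdW.
  by move=> x xe; apply: ca; exact: nearbdW xe.
have [q [sq q0 qbd q1 bse]] := ex_collapse m e0.
have e40 : 0 < e / 4 by lra.
have e4e : e / 4 <= 20^-1 by lra.
have sa' : smooth_on (nearbd (e / 4)) (fun x => a (q (x, 1))).
  apply: (smooth_on_comp sa); first by smooth_tac.
  by move=> x xe; apply: qbd; apply: nearbdW xe; lra.
have sc' : smooth (fun x => c (q (x, 1))) by apply/smooth_onT; smooth_tac.
have ca' x : nearbd (e / 4) x -> c (q (x, 1)) = p (a (q (x, 1))).
  by move=> xe; apply: ca; apply: qbd; apply: nearbdW xe; lra.
have ay' x : side (e / 4) x -> a (q (x, 1)) = a (cns 0 0) by move=> /q1 ->.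
have [h' [e' [sh' e'0 h'a [e'' e''0 [K [sK Kc Kh KD]]]]]] :=
  compress_straight hp mN e40 e4e sa' sc' ca' ay'.
have [f1 [f10 f1e f1e']] := ex_common_lower e'0 e''0.
have [f [f0 ff1 fe]] := ex_common_lower f10 e0.
have f42 : f / 4 < f / 2 by lra.
have [b [sb b01 b1 b0]] := ex_bump m.+1 f42.
pose v x := 1 - b x.
have sv : @smooth R (euclSpace R m.+1) (realSpace R) v.
  by apply/smooth_onT; rewrite /v; smooth_tac.
have v1 x : inner (f / 2) x -> v x = 1 by move=> xi; rewrite /v b0// subr0.
have v0 x : nearbd (f / 4) x -> v x = 0 by move=> xi; rewrite /v b1// subrr.
have cover (x : euclSpace R m.+1) : nearbd f x \/ inner (f / 2) x by apply: nearbdU; lra.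
have caq x s : nearbd f x -> c (q (x, s)) = p (a (q (x, s))).
  by move=> xf; apply: ca; apply: qbd; exact: nearbdW fe _ xf.
pose h x := if `[< nearbd f x >] then a (q (x, v x)) else h' x.
exists h, (f / 4); split.
- apply: (@smooth_patch _ _ _ (nearbd f) (inner (f / 2))) => //.
  + exact: dopen_nearbd.
  + exact: dopen_inner.
  + apply: (smooth_on_comp sa); first by smooth_tac.
    by move=> x xf; apply: qbd; exact: nearbdW fe _ xf.
  + exact: smoothW.
  + move=> x xf /v1 ->; rewrite h'a//; apply: nearbdW xf; lra.
- lra.
- move=> x xf; rewrite /h asboolT; first by rewrite v0// q0.
  by apply: nearbdW xf; lra.
(* [c] is defined everywhere, so it can first be slid along [q] for the time [v x]. The outcome
   already equals [p \o h] in the collar. *)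
apply: (@hrel_trans _ _ _ _ (fun x => c (q (x, v x)))).
  exists (f / 4); first lra.
  apply: (@homrel_of _ _ _ _ (fun z : prodSpace (euclSpace R m.+1) (realSpace R) =>
    c (q (z.1, (z.2 : R) * v z.1)))).
  - by apply/smooth_onT; smooth_tac.
  - by move=> x /=; rewrite mul0r q0.
  - by move=> x /=; rewrite mul1r.
  - by move=> x s xf _ /=; rewrite v0// mulr0 q0.
exists (f / 4); first lra.
(* Away from the collar [v] is 1 and [K] finishes the homotopy; on the overlap [K] does not move,
   since [f] is at most [e'']. *)
exists (fun z => if `[< nearbd f z.1 >] then c (q (z.1, v z.1)) else K z); split.
- apply: (@smooth_patch _ _ _ 
    [set z : prodSpace (euclSpace R m.+1) (realSpace R) | nearbd f z.1]
    [set z : prodSpace (euclSpace R m.+1) (realSpace R) | inner (f / 2) z.1]) => //.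
  + by apply: dopen_preimage (@dopen_nearbd R _ _); exact: smooth_fst.
  + by apply: dopen_preimage (@dopen_inner R _ _); exact: smooth_fst.
  + by move=> z; exact: cover.
  + by smooth_tac.
  + exact: smoothW.
  + move=> [x s] /= xf /v1 ->; rewrite KD//; apply: nearbdW xf; lra.
- move=> x s s0 /=; case: asboolP => // xf.
  by rewrite Kc//; have [//|/v1 ->] := cover x.
- move=> x s s1 /=; rewrite /h; case: asboolP => // xf; first exact: caq.
  by rewrite Kh.
- by move=> x s xf /=; rewrite asboolT//; apply: nearbdW xf; lra.
Qed.

End CompressionLemma.

(** * Extension over one cell *)

Section CellExtension.
Variable R : realType.

Definition toI (r : R) : unitI R :=
  if pselect (r \in `[0, 1]%classic) is left h then exist _ r h else iend R false.

Lemma val_toI (r : R) : 0 <= r <= 1 -> val (toI r) = r.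
Proof.
move=> r01; rewrite /toI; case: pselect => // -[].
by rewrite inE /= in_itv.
Qed.

Lemma unitI01 (t : unitI R) : 0 <= (val t : R) <= 1.
Proof. by have := valP t; rewrite inE /= in_itv. Qed.

Lemma cubeSpace01 n (x : cubeSpace R n) j : 0 <= (val x : 'rV[R]_n) 0 j <= 1.
Proof. by have := valP x; rewrite inE; exact. Qed.

Lemma cube0 n : (0 : 'rV[R]_n) \in @cube R n.
Proof. by rewrite inE => j; rewrite mxE lexx ler01. Qed.

Definition toCube n (y : 'rV[R]_n) : cubeSpace R n :=
  if pselect (y \in @cube R n) is left h then exist _ y h else exist _ 0 (cube0 n).

Lemma val_toCube n (y : 'rV[R]_n) : cube y -> val (toCube y) = y.
Proof. by move=> cy; rewrite /toCube; case: pselect => // -[]; rewrite inE. Qed.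

Lemma smooth_on_valP (X Y : diffSpace R) (A : set X) (B : set Y) (F : X -> subSpace B) :
  smooth_on A (fun x => val (F x)) -> smooth_on A F.
Proof. by move=> sF n U p Up pA; exact: (sF _ _ _ Up pA). Qed.

Lemma smooth_on_toI (X : diffSpace R) (A : set X) (f : X -> R) :
  @smooth_on R X (realSpace R) A f -> (forall x, A x -> 0 <= f x <= 1) ->
  smooth_on A (fun x => toI (f x)).
Proof.
move=> sf f01; apply: smooth_on_valP; apply: smooth_on_ext sf => x /f01 h.
by rewrite val_toI.
Qed.

Lemma smooth_on_toCube n (X : diffSpace R) (A : set X) (f : X -> 'rV[R]_n) :
  @smooth_on R X (euclSpace R n) A f -> (forall x, A x -> cube (f x)) ->
  smooth_on A (fun x => toCube (f x)).
Proof.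
move=> sf f01; apply: smooth_on_valP; apply: smooth_on_ext sf => x /f01 h.
by rewrite val_toCube.
Qed.

(** The collapse of the collar in one coordinate: constant within e/2 of each end, the identity
    between e and 1 - e. It moves a point only inside a zone that an e-tame map does not
    distinguish. *)
Definition plateau (e t : R) : R :=
  ramp (e / 2) e t * t * (1 - ramp (1 - e) (1 - e / 2) t) + ramp (1 - e) (1 - e / 2) t.

Lemma plateau_le e t : 0 < e <= 2^-1 -> t <= e / 2 -> plateau e t = 0.
Proof. by move=> e0 te; rewrite /plateau !ramp_le; lra. Qed.

Lemma plateau_ge e t : 0 < e <= 2^-1 -> 1 - e / 2 <= t -> plateau e t = 1.
Proof.
move=> e0 te; rewrite /plateau [ramp (1 - e) _ _]ramp_ge; lra.
Qed.

Lemma plateau_mid e t : 0 < e <= 2^-1 -> e <= t <= 1 - e -> plateau e t = t.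
Proof. by move=> e0 te; rewrite /plateau ramp_ge ?ramp_le; lra. Qed.

Lemma plateau01 e t : 0 < e <= 2^-1 -> 0 <= plateau e t <= 1.
Proof.
move=> e0; have [te|te] := leP t (e / 2); first by rewrite plateau_le//; lra.
have [te'|te'] := leP (1 - e / 2) t; first by rewrite plateau_ge//; lra.
rewrite /plateau; have := ramp01 (e / 2) e t; have := ramp01 (1 - e) (1 - e / 2) t.
set T := ramp (1 - e) _ _; set S := ramp (e / 2) _ _ => T01 S01.
have /andP[S0 S1] := S01; have /andP[T0 T1] := T01; have t0 : 0 <= t by lra.
have u0 : 0 <= S * t by exact: mulr_ge0.
have u1 : S * t <= 1 by apply: mulr_ile1 => //; lra.
have v0 : 0 <= S * t * (1 - T) by apply: mulr_ge0 => //; lra.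
have v1 : 0 <= (1 - S * t) * (1 - T) by apply: mulr_ge0; lra.
by lra.
Qed.

Lemma smooth_plateau (X : diffSpace R) (A : set X) e (f : X -> R) :
  @smooth_on R X (realSpace R) A f ->
  @smooth_on R X (realSpace R) A (fun x => plateau e (f x)).
Proof.
move=> sf; rewrite /plateau; apply: smooth_onD; last exact: smooth_ramp.
apply: smooth_onM; first by apply: smooth_onM => //; exact: smooth_ramp.
by apply: smooth_onD; [smooth_tac|apply: smooth_onN; exact: smooth_ramp].
Qed.

(* An [e]-tame map does not distinguish [t] from [t'] in any coordinate. *)
Definition same_zone (e t t' : R) : Prop :=
  [\/ t = t', t <= e /\ t' <= e | 1 - e <= t /\ 1 - e <= t'].

Lemma same_zone_plateau e t : 0 < e <= 2^-1 -> 0 <= t <= 1 -> same_zone e t (plateau e t).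
Proof.
move=> e0 t01; have [te|te] := leP t e.
  apply: Or32; split=> //.
  rewrite /plateau [ramp (1 - e) _ _]ramp_le; [|lra..].
  have := ramp01 (e / 2) e t; set S := ramp _ _ _ => S01; nra.
have [te'|te'] := leP (1 - e) t; last by apply: Or31; rewrite plateau_mid//; lra.
apply: Or33; split=> //.
rewrite /plateau ramp_ge; [|lra..].
have := ramp01 (1 - e) (1 - e / 2) t; set S := ramp _ _ _ => S01; nra.
Qed.

Lemma same_zone_conv e s t t' : 0 <= s <= 1 -> same_zone e t t' ->
  same_zone e t ((1 - s) * t + s * t').
Proof.
move=> s01 [<-|[h h']|[h h']]; [apply: Or31; ring|apply: Or32|apply: Or33];
  split => //; nra.
Qed.

Lemma dist_true e (u : R) : 1 - e <= u -> u <= 1 -> `|u - true%:R| <= e.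
Proof. by move=> u1 u2; rewrite ler0_norm /=; lra. Qed.

(** The coordinates of [s] are replaced by those of [s'] one at a time. The coordinate where both
    equal [a] keeps the intermediate points in the boundary, and when a coordinate changes within an
    end zone, both points have the same value as the one snapped to that end. *)
Lemma tame_same_zone n (V : diffSpace R) (phi : bdcubeSpace R n -> V) e
    (s s' : bdcubeSpace R n) : tame_map_eps phi e ->
  (forall j, same_zone e ((val s : 'rV[R]_n) 0 j) ((val s' : 'rV[R]_n) 0 j)) ->
  (exists j (a : bool), (val s : 'rV[R]_n) 0 j = a%:R /\ (val s' : 'rV[R]_n) 0 j = a%:R) ->
  phi s = phi s'.
Proof.
move=> [e0 tphi] zs [j0 [a0 [sj0 s'j0]]].
have s01 j : 0 <= (val s : 'rV[R]_n) 0 j <= 1.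
  by have := valP s; rewrite inE => -[] + _; exact.
have s'01 j : 0 <= (val s' : 'rV[R]_n) 0 j <= 1.
  by have := valP s'; rewrite inE => -[] + _; exact.
pose y k : 'rV[R]_n :=
  \row_j if (j < k)%N then (val s' : 'rV[R]_n) 0 j else (val s : 'rV[R]_n) 0 j.
have y01 k j : 0 <= y k 0 j <= 1 by rewrite mxE; case: ifP.
have ybd k : y k \in @bdcube R n.
  by rewrite inE; split=> //; exists j0, a0; rewrite mxE; case: ifP.
pose Y k : bdcubeSpace R n := exist _ (y k) (ybd k).
have snap k (j : 'I_n) (a : bool) :
    (\row_i (if i == j then a%:R else y k 0 i)) \in @bdcube R n.
  rewrite inE; split; last by exists j, a; rewrite mxE eqxx.
  by move=> i; rewrite mxE; case: ifP => // _; case: a; rewrite /= ?lexx ?ler01.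
have step k : (k < n)%N -> phi (Y k) = phi (Y k.+1).
  move=> kn; pose j := Ordinal kn.
  have yj : y k 0 j = (val s : 'rV[R]_n) 0 j by rewrite mxE ltnn.
  have y'j : y k.+1 0 j = (val s' : 'rV[R]_n) 0 j by rewrite mxE ltnSn.
  have yi i : i != j -> y k.+1 0 i = y k 0 i.
    by move=> ij; rewrite !mxE ltnS leq_eqVlt -(inj_eq val_inj)/= in ij *; rewrite (negPf ij).
  have close (a : bool) : `|y k 0 j - a%:R| <= e -> `|y k.+1 0 j - a%:R| <= e ->
      phi (Y k) = phi (Y k.+1).
    move=> h1 h2.
    pose S : bdcubeSpace R n :=
      exist _ (\row_i (if i == j then a%:R else y k 0 i)) (snap k j a).
    rewrite (tphi j a (Y k) S h1 erefl).
    apply/esym; apply: (tphi j a (Y k.+1) _ h2) => /=.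
    by apply/rowP => i; rewrite !mxE; case: eqP => // /eqP/yi; rewrite !mxE.
  have : same_zone e (y k 0 j) (y k.+1 0 j) by rewrite yj y'j.
  case=> [E|[h1 h2]|[h1 h2]].
  - congr phi; apply: val_inj => /=; apply/rowP => i.
    by have [->//|/yi] := eqVneq i j.
  - apply: (close false); rewrite subr0 ger0_norm//.
      by have /andP[] := y01 k j.
    by have /andP[] := y01 k.+1 j.
  - have /andP[_ l1] := y01 k j; have /andP[_ l2] := y01 k.+1 j.
    by apply: (close true); exact: dist_true.
have E0 : s = Y 0%N by apply: val_inj; apply/rowP => i; rewrite mxE.
have En : s' = Y n by apply: val_inj; apply/rowP => i; rewrite mxE ltn_ord.
have all k : (k <= n)%N -> phi (Y 0%N) = phi (Y k).
  elim: k => [_|k IH kn]; first reflexivity.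
  exact: etrans (IH (ltnW kn)) (step k kn).
rewrite E0 En; exact: all (leqnn n).
Qed.

Lemma tame_homotopy_same_zone (V Z : diffSpace R) (G : prodSpace V (unitI R) -> Z) e v
    (t t' : unitI R) : tame_homotopy_eps G e ->
  same_zone e (val t) (val t') -> G (v, t) = G (v, t').
Proof.
move=> [e0 tG]; have /andP[t0 t1] := unitI01 t; have /andP[t'0 t'1] := unitI01 t'.
case=> [/val_inj->//|[h h']|[h h']].
  by rewrite !(tG v _ false)// subr0 ger0_norm.
by rewrite !(tG v _ true)//; exact: dist_true.
Qed.

(** A plot of the cube with values in the boundary is a plot of the boundary, both having the
    subspace diffeology. Hence a pointwise choice of boundary points is automatically smooth. *)
Lemma smooth_on_bd n (X T W : diffSpace R) (A : set X) (q : X -> cubeSpace R n)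
    (tau : X -> T) (u : prodSpace (bdcubeSpace R n) T -> W) (F : X -> W) :
  smooth u -> smooth_on A q -> smooth_on A tau ->
  (forall x, A x -> exists2 s, bd_incl s = q x & F x = u (s, tau x)) ->
  smooth_on A F.
Proof.
(* Localising at a point of [U] yields a boundary point, which is the default value of the choice
   outside [U]. *)
move=> su sq st AF k U P UP PA; apply: plot_local => [|z0 Uz0].
  exact: plot_open UP.
have [s0 _ _] := AF _ (PA _ Uz0).
have /choice[sg sgP] : forall z, exists s, U z ->
    bd_incl s = q (P z) /\ F (P z) = u (s, tau (P z)).
  move=> z; have [Uz|nUz] := pselect (U z); last by exists s0.
  by have [s E1 E2] := AF _ (PA _ Uz); exists s.
exists U; split=> //.
have Usg : plot U (sg : _ -> bdcubeSpace R n).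
  apply: (plot_ext (sq _ _ _ UP PA : plot U (fun z => val (q (P z))))) => z /sgP[<- _].
  by [].
have := su _ _ (fun z => (sg z, tau (P z))) (conj Usg (st _ _ _ UP PA)).
by move=> H; apply: plot_ext H _ => z /sgP[_ E] /=; rewrite E.
Qed.

Lemma bd_incl_inj n : injective (@bd_incl R n).
Proof. by move=> s s' E; apply: val_inj; exact: (congr1 val E). Qed.

Lemma ex_ext n (W : Type) (u : bdcubeSpace R n -> W) (q : cubeSpace R n) (w0 : W) :
  exists w, (forall s, bd_incl s = q -> w = u s) /\
    ((forall s, bd_incl s <> q) -> w = w0).
Proof.
have [[s sq]|ns] := pselect (exists s, bd_incl s = q).
  exists (u s); split=> [s'|/(_ s)//]; by rewrite -sq => /bd_incl_inj->.
exists w0; split=> // s sq; by exfalso; apply: ns; exists s.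
Qed.

End CellExtension.

(** * Collapse of a collar and extension of homotopies *)

Section Collar.
Variable R : realType.
Implicit Types (n : nat) (V Y Z : diffSpace R) (d e r t : R).

Definition plateau_cube n d (x : euclSpace R n) : cubeSpace R n :=
  toCube (\row_j plateau d ((x : 'rV[R]_n) 0 j)).

(* The segment from [x] to [plateau_cube d x]. *)
Definition blend n d (x : cubeSpace R n) r : cubeSpace R n :=
  toCube (\row_j ((1 - r) * (val x : 'rV[R]_n) 0 j
                  + r * plateau d ((val x : 'rV[R]_n) 0 j))).

Lemma val_plateau_cube n d (x : euclSpace R n) : 0 < d <= 2^-1 ->
  val (plateau_cube d x) = \row_j plateau d ((x : 'rV[R]_n) 0 j).
Proof. by move=> d0; rewrite val_toCube// => j; rewrite mxE plateau01. Qed.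

Lemma smooth_plateau_cube n d : 0 < d <= 2^-1 -> smooth (@plateau_cube n d).
Proof.
move=> d0; apply/smooth_onT; apply: smooth_on_toCube => [|x _ j]; last first.
  by rewrite mxE plateau01.
by apply: smooth_on_row => j; apply: smooth_plateau; smooth_tac.
Qed.

Lemma plateau_cube_bd n d (x : euclSpace R n) : 0 < d <= 2^-1 ->
  nearbd (d / 2) x -> exists s, bd_incl s = plateau_cube d x.
Proof.
move=> d0 [j xj]; have [|s ->] := @bdptsE _ _ (plateau_cube d x); last by exists s.
split; first exact: (set_mem (valP (plateau_cube d x))).
exists j; case: xj => xj; [exists false|exists true];
  rewrite val_plateau_cube// mxE /=.
  by rewrite plateau_le//; lra.
by rewrite plateau_ge//; lra.
Qed.

Lemma blend_cube n d (x : cubeSpace R n) r : 0 < d <= 2^-1 -> 0 <= r <= 1 ->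
  cube (\row_j ((1 - r) * (val x : 'rV[R]_n) 0 j + r * plateau d ((val x : 'rV[R]_n) 0 j))).
Proof.
move=> e0 r01 j; rewrite mxE.
have := cubeSpace01 x j; have := plateau01 ((val x : 'rV[R]_n) 0 j) e0.
move: (plateau _ _) => u u01; move: ((val x : 'rV[R]_n) 0 j) => t t01.
have /andP[r0 r1] := r01; have /andP[u0 u1] := u01; have /andP[t0 t1] := t01.
have a1 : 0 <= (1 - r) * t by apply: mulr_ge0 => //; lra.
have a2 : 0 <= r * u by apply: mulr_ge0.
have a3 : 0 <= (1 - r) * (1 - t) by apply: mulr_ge0; lra.
have a4 : 0 <= r * (1 - u) by apply: mulr_ge0 => //; lra.
by lra.
Qed.

Lemma blend0 n d (x : cubeSpace R n) : 0 < d <= 2^-1 -> blend d x 0 = x.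
Proof.
move=> d0; apply: val_inj; rewrite val_toCube; last by apply: blend_cube => //; lra.
by apply/rowP => j; rewrite mxE; ring.
Qed.

Lemma blend1 n d (x : cubeSpace R n) : 0 < d <= 2^-1 ->
  blend d x 1 = plateau_cube d (val x).
Proof. by move=> d0; congr toCube; apply/rowP => j; rewrite !mxE; ring. Qed.

Lemma smooth_on_blend (X : diffSpace R) (A : set X) n d (f : X -> cubeSpace R n)
    (g : X -> R) : 0 < d <= 2^-1 -> smooth_on A f ->
  @smooth_on R X (realSpace R) A g -> (forall x, A x -> 0 <= g x <= 1) ->
  smooth_on A (fun x => blend d (f x) (g x)).
Proof.
move=> d0 sf sg g01; apply: smooth_on_toCube => [|x Ax]; last by apply: blend_cube; auto.
apply: smooth_on_row => j.
have sx : @smooth_on R X (realSpace R) A (fun x => (val (f x) : 'rV[R]_n) 0 j).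
  by apply: smooth_on_coord => m U q Uq qA; exact: (sf _ _ _ Uq qA).
apply: smooth_onD; apply: smooth_onM => //; first by smooth_tac.
exact: smooth_plateau.
Qed.

(** A coordinate equal to 0 or 1 is fixed by [plateau], so the segment from a boundary point stays
    in the boundary; every coordinate stays in its zone, so the tame [phi] is constant along it. *)
Lemma blend_bd n V (phi : bdcubeSpace R n -> V) d (s : bdcubeSpace R n) r :
  tame_map_eps phi d -> 0 <= r <= 1 ->
  exists2 s', bd_incl s' = blend d (bd_incl s) r & phi s' = phi s.
Proof.
move=> td r01; have d0 : 0 < d <= 2^-1 by case: td.
have [cs [j0 [a0 sj0]]] := set_mem (valP s).
have bl : val (blend d (bd_incl s) r) = \row_j ((1 - r) * (val s : 'rV[R]_n) 0 j
    + r * plateau d ((val s : 'rV[R]_n) 0 j)).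
  by rewrite val_toCube//; exact: blend_cube.
have blj : (val (blend d (bd_incl s) r) : 'rV[R]_n) 0 j0 = a0%:R.
  rewrite bl mxE sj0; case: (a0) => /=.
    by rewrite plateau_ge//; [ring|lra].
  by rewrite plateau_le//; [ring|lra].
have [|s' E] := @bdptsE _ _ (blend d (bd_incl s) r).
  split; first exact: (set_mem (valP (blend d (bd_incl s) r))).
  by exists j0, a0.
have E' : val s' = val (blend d (bd_incl s) r) by rewrite E.
exists s' => //; apply/esym; apply: (tame_same_zone td) => [j|].
  by rewrite E' bl mxE; apply: same_zone_conv => //; apply: same_zone_plateau.
by exists j0, a0; rewrite E'.
Qed.

(** The homotopy starts at [b] composed with the collapse instead of [b]: only after the collapse
    does a whole neighbourhood of the boundary land in the boundary, where [G] can be applied. *)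
Lemma homotopy_extension n V Z (phi : bdcubeSpace R n -> V)
    (G : prodSpace V (unitI R) -> Z) (b : cubeSpace R n -> Z) d e :
  smooth phi -> 0 < d <= 2^-1 -> 0 < e <= 2^-1 -> smooth G -> smooth b ->
  (forall s, G (phi s, iend R false) = b (bd_incl s)) ->
  exists H : prodSpace (euclSpace R n) (realSpace R) -> Z,
    [/\ smooth H,
        forall x t, t <= e / 2 -> H (x, t) = b (plateau_cube d x),
        forall x t, 1 - e / 2 <= t -> H (x, t) = H (x, 1) &
        forall x s t, nearbd (d / 4) x -> bd_incl s = plateau_cube d x ->
          H (x, t) = G (phi s, toI (plateau e t))].
Proof.
move=> sphi d0 e0 sG sb G0.
pose Q : euclSpace R n -> cubeSpace R n := plateau_cube d.
have sQ : smooth Q by exact: smooth_plateau_cube.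
have d42 : d / 4 < 3 * d / 8 by lra.
(* [w] is already 0 at depth 3d/8, whereas the collapse sends everything up to depth d/2 into the
   boundary; the formulas overlap in between. *)
have [w [sw w01 w1 w0]] := ex_bump n d42.
pose PS := prodSpace (euclSpace R n) (realSpace R).
pose tau (z : PS) : R := plateau e z.2 * w z.1.
have tau01 z : 0 <= tau z <= 1.
  have /andP[u0 u1] := plateau01 (z.2 : R) e0; have /andP[v0 v1] := w01 z.1.
  by rewrite mulr_ge0//= mulr_ile1.
have stau : @smooth R PS (realSpace R) tau.
  apply/smooth_onT; apply: smooth_onM; first by apply: smooth_plateau; smooth_tac.
  by smooth_tac.
have [H HE] := choice (fun z =>
  ex_ext (fun s => G (phi s, toI (tau z))) (Q z.1) (b (Q z.1))).
(* At time 0 the formula with [G] gives the same value as [b], by compatibility of [G] with [b];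
   this makes the two formulas match. *)
have Hb z : tau z = 0 -> H z = b (Q z.1).
  move=> z0; have [Hb Hd] := HE z.
  have [[s sq]|ns] := pselect (exists s, bd_incl s = Q z.1).
    rewrite (Hb s sq) z0 -sq -G0; congr (G (_, _)); apply: val_inj.
    by rewrite val_toI //; lra.
  by apply: Hd => s sq; apply: ns; exists s.
exists H; split.
- apply/smooth_onT; apply: (@smooth_on_patch _ PS Z setT
    [set z : PS | nearbd (d / 2) z.1] [set z : PS | inner (3 * d / 8) z.1] H H
    (fun z => b (Q z.1))) => //.
  + by apply: dopen_preimage (@dopen_nearbd R _ _); exact: smooth_fst.
  + by apply: dopen_preimage (@dopen_inner R _ _); exact: smooth_fst.
  + by move=> z _; apply: nearbdU; lra.
  + rewrite setTI; apply: (@smooth_on_bd R n PS (unitI R) Z _ (fun z => Q z.1)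
      (fun z => toI (tau z)) (fun z => G (phi z.1, z.2))).
    * by apply/smooth_onT; smooth_tac.
    * by smooth_tac.
    * by apply: smooth_on_toI => //; exact: smoothW.
    * by move=> z /(plateau_cube_bd d0)[s sq]; exists s => //; exact: (HE z).1 _ sq.
  + by smooth_tac.
  + by move=> z _ zi; apply: Hb; rewrite /tau w0// mulr0.
- by move=> x t te; rewrite Hb// /tau /= plateau_le// mul0r.
- move=> x t te; have Et : tau (x, t) = tau (x, 1).
    by rewrite /tau /= !plateau_ge//; lra.
  have [Hb1 Hd1] := HE (x, t); have [Hb2 Hd2] := HE (x, 1).
  have [[s sq]|ns] := pselect (exists s, bd_incl s = Q x).
    by rewrite (Hb1 s sq) (Hb2 s sq) Et.
  by rewrite Hd1 ?Hd2// => s sq; apply: ns; exists s.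
- by move=> x s t xd sq; rewrite ((HE (x, t)).1 _ sq) /tau /= w1// mulr1.
Qed.

End Collar.

(** * The extension problem on one cell *)

Section CellExtension.
Variable R : realType.

(** Three homotopies in succession: from [b] along [blend] to [b] after the collapse, then the
    extension [H0] of [G], then the homotopy [K] given by [compress]. The first and the last take
    place at times when [G] is at rest by tameness, so the restriction to the boundary is still
    exactly [G]. The result rests only within e/4 of the ends, hence the loss of a factor 4. *)
Lemma extend_cell N (V Y Z : diffSpace R) (p : Y -> Z) n
    (phi : bdcubeSpace R n -> V) (f : V -> Y) (G : prodSpace V (unitI R) -> Z)
    (b : cubeSpace R n -> Z) (e : R) :
  N_equivalence N p -> (n <= N)%N ->
  smooth phi -> tame_map phi -> smooth f -> smooth b ->
  smooth G -> tame_homotopy_eps G e ->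
  (forall v, G (v, iend R true) = p (f v)) ->
  (forall s, G (phi s, iend R false) = b (bd_incl s)) ->
  exists (h : cubeSpace R n -> Y) (H : prodSpace (cubeSpace R n) (unitI R) -> Z),
    [/\ smooth h, smooth H, tame_homotopy_eps H (e / 4),
        (forall s, h (bd_incl s) = f (phi s)) /\
        (forall s t, H (bd_incl s, t) = G (phi s, t)) &
        (forall x, H (x, iend R false) = b x) /\
        (forall x, H (x, iend R true) = p (h x))].
Proof.
move=> hp nN sphi [d td] sf sb sG tG G1 G0.
have e0 : 0 < e <= 2^-1 by case: tG.
have d0 : 0 < d <= 2^-1 by case: td.
have e42 : e / 4 < e / 2 by lra.
have e438 : e / 4 < 3 * e / 8 by lra.
have e21 : e / 2 <= 1 - 3 * e / 8 by lra.
have e2e : e / 2 <= e by lra.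
have ge0 : 0 <= e by lra.
have e40 : 0 <= e / 4 by lra.
have e4b : 0 < e / 4 <= 2^-1 by lra.
have e41 : 1 - e / 4 <= 1 by lra.
have e11 : 1 - e <= 1 by lra.
have e841 : 1 - 3 * e / 8 <= 1 - e / 4 by lra.
have e80 : 0 < e / 8 by lra.
have e382 : 3 * e / 8 < e / 2 by lra.
have e238 : 1 - e / 2 < 1 - 3 * e / 8 by lra.
have e281 : 1 - e / 2 <= 1 - 3 * e / 8 by lra.
have e81 : 1 - e <= 1 - 3 * e / 8 by lra.
have close0 (u : R) : `|u - false%:R| <= e / 4 -> u <= e / 4.
  by rewrite ler_norml /=; lra.
have close1 (u : R) : `|u - true%:R| <= e / 4 -> 1 - e / 4 <= u.
  by rewrite ler_norml /=; lra.
(* The time of [K]: it runs from 0 to 1 while [t] goes from 1 - 3e/8 to 1 - e/4. *)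
pose kappa (t : R) := (t - (1 - 3 * e / 8)) / (e / 8).
have kappa_le (t : R) : t <= 1 - 3 * e / 8 -> kappa t <= 0.
  by move=> te; rewrite /kappa pmulr_lle0 ?invr_gt0//; lra.
have kappa_ge (t : R) : 1 - e / 4 <= t -> 1 <= kappa t.
  by move=> te; rewrite /kappa ler_pdivlMr//; lra.
(* A default value for [a] off the boundary. As [V] may be empty, the point of [Y] comes from
   surjectivity on path components. *)
have [y0 _] := pi0_surj hp (b (toCube 0)).
pose Q : euclSpace R n -> cubeSpace R n := plateau_cube d.
have sQ : smooth Q by exact: smooth_plateau_cube.
have [a aE] := choice (fun x => ex_ext (fun s => f (phi s)) (Q x) y0).
have [H0 [sH0 H0early H0late H0bd]] := homotopy_extension sphi d0 e0 sG sb G0.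
pose c x := H0 (x, 1).
have sc : smooth c by rewrite /c; apply/smooth_onT; smooth_tac.
have sa : smooth_on (nearbd (d / 4)) a.
  apply: (@smooth_on_bd R n (euclSpace R n) (realSpace R) Y _ Q (fun=> 0)
    (fun z => f (phi z.1))).
  - by apply/smooth_onT; smooth_tac.
  - by smooth_tac.
  - by smooth_tac.
  - move=> x xd; have [||s sq] := @plateau_cube_bd _ _ d x => //.
      by apply: nearbdW xd; lra.
    by exists s => //; exact: (aE x).1 _ sq.
have toI1 t : 1 - e / 2 <= t -> toI (plateau e t) = iend R true.
  by move=> te; apply: val_inj; rewrite val_toI ?plateau01// plateau_ge.
have ca x : nearbd (d / 4) x -> c x = p (a x).
  move=> xd; have [||s sq] := @plateau_cube_bd _ _ d x => //.
    by apply: nearbdW xd; lra.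
  by rewrite ((aE x).1 _ sq) -G1 /c (H0bd _ _ _ xd sq) toI1//; lra.
have d40 : 0 < d / 4 by lra.
have [h [d' [sh d'0 ha [d'' d''0 [K [sK Kc Kh KD]]]]]] := compress hp nN d40 sa sc ca.
pose CI := prodSpace (cubeSpace R n) (unitI R).
pose time (z : CI) : R := val z.2.
have stime : @smooth R CI (realSpace R) time.
  by move=> m U q [_ Uq].
have spt : @smooth R CI (euclSpace R n) (fun z => val z.1).
  by move=> m U q [Uq _].
have dlt (u : R) : @dopen R CI [set z | time z < u].
  by apply: dopen_lt => //; exact: smooth_cstR.
have dgt (u : R) : @dopen R CI [set z | u < time z].
  by apply: dopen_lt => //; exact: smooth_cstR.
pose A2 := [set z : CI | time z < 1 - 3 * e / 8].
pose H2 (z : CI) : Z := if `[< A2 z >] then H0 (val z.1, time z)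
  else K (val z.1, kappa (time z)).
have sH2 : smooth H2.
  apply: (@smooth_patch _ CI Z A2 [set z : CI | 1 - e / 2 < time z]);
    [exact: dlt|exact: dgt|..].
  - by move=> z; case: (ltP (time z) (1 - 3 * e / 8)) => [|/(lt_le_trans e238)]; [left|right].
  - by smooth_tac.
  - by rewrite /kappa; smooth_tac.
  - move=> z z1 z2; rewrite H0late; last exact: ltW.
    by rewrite Kc//; apply: kappa_le; exact: ltW.
pose A1 := [set z : CI | time z < e / 2].
pose sigma (t : R) := ramp (e / 4) (3 * e / 8) t.
have sigma01 t : 0 <= sigma t <= 1 by exact: ramp01.
pose H z : Z := if `[< A1 z >] then b (blend d z.1 (sigma (time z))) else H2 z.
have sH : smooth H.
  apply: (@smooth_patch _ CI Z A1 [set z : CI | 3 * e / 8 < time z]);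
    [exact: dlt|exact: dgt|..].
  - by move=> z; case: (ltP (time z) (e / 2)) => [|/(lt_le_trans e382)]; [left|right].
  - apply: (smooth_comp_on sb); apply: smooth_on_blend => //.
      by apply: smoothW; exact: (@smooth_fst R (cubeSpace R n) (unitI R)).
    by apply: smooth_ramp; exact: smoothW.
  - exact: smoothW.
  - move=> z z1 z2; rewrite /A1/= in z1 z2.
    rewrite /H2 asboolT; last exact: lt_le_trans z1 e21.
    rewrite H0early ?(ltW z1)//.
    by rewrite /sigma ramp_ge ?blend1//; exact: ltW.
have H_early x (t : unitI R) : (val t : R) < e / 2 -> H (x, t) = b (blend d x (sigma (val t))).
  by move=> te; rewrite /H asboolT.
have H_mid x (t : unitI R) : e / 2 <= (val t : R) -> (val t : R) < 1 - 3 * e / 8 ->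
    H (x, t) = H0 (val x, val t).
  move=> te te'; rewrite /H asboolF; last by move=> /lt_le_trans/(_ te); rewrite ltxx.
  by rewrite /H2 asboolT.
have H_late x (t : unitI R) : 1 - 3 * e / 8 <= (val t : R) ->
    H (x, t) = K (val x, kappa (val t)).
  move=> te; have te' : e / 2 <= (val t : R) by exact: le_trans e21 te.
  rewrite /H asboolF; last by move=> /lt_le_trans/(_ te'); rewrite ltxx.
  by rewrite /H2 asboolF//; move=> /lt_le_trans/(_ te); rewrite ltxx.
have H_start x (t : unitI R) : (val t : R) <= e / 4 -> H (x, t) = b x.
  by move=> te; rewrite H_early ?(le_lt_trans te e42)// /sigma ramp_le ?blend0.
have H_end x (t : unitI R) : 1 - e / 4 <= (val t : R) -> H (x, t) = p (h (val x)).
  by move=> te; rewrite H_late ?Kh ?(le_trans e841 te)//; exact: kappa_ge.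
have val0 : (val (iend R false) : R) = 0 by [].
have val1 : (val (iend R true) : R) = 1 by [].
exists (fun x => h (val x)), H; split=> //.
- exact: smooth_comp.
- split=> // x t [] te.
    by rewrite (H_end x t (close1 _ te)) H_end ?val1.
  by rewrite (H_start x t (close0 _ te)) H_start ?val0.
- have near (s : bdcubeSpace R n) u : 0 < u -> nearbd u (val (bd_incl s)).
    by move=> u0; exact: bdpts_nearbd (bd_incl_bdpts s).
  have le01 : 0 <= (1 : R) <= 1 by rewrite ler01 lexx.
  split=> [s|s t].
    rewrite ha; last exact: near.
    have [s' sq ss'] := blend_bd s td le01.
    by rewrite ((aE _).1 s') ?ss'// sq blend1.
  have t01 := unitI01 t.
  have [s' sq ss'] := blend_bd s td le01; rewrite blend1// in sq.
  have [te|te] := ltP (val t : R) (e / 2).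
    rewrite H_early//; have [s1 sq1 ss1] := blend_bd s td (sigma01 (val t)).
    rewrite -sq1 -G0 ss1; apply: (tame_homotopy_same_zone _ tG).
    by apply: Or32; rewrite val0; split=> //; exact: le_trans (ltW te) e2e.
  have [te'|te'] := ltP (val t : R) (1 - 3 * e / 8).
    (* [plateau e t] lies in the same zone as [t], so the e-tame [G] has the same value at both. *)
    rewrite H_mid// (H0bd _ _ _ (near _ _ d40) sq) ss'.
    apply: (tame_homotopy_same_zone _ tG); rewrite val_toI ?plateau01//.
    have := same_zone_plateau e0 t01.
    by case=> [E|[? ?]|[? ?]]; [apply: Or31; rewrite -E|apply: Or32|apply: Or33].
  rewrite H_late// KD; last exact: near.
  rewrite /c (H0bd _ _ _ (near _ _ d40) sq) ss' toI1.
  2: exact: le_trans e281 (le_trans e841 e41).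
  apply: (tame_homotopy_same_zone _ tG).
  by apply: Or33; rewrite val1; split=> //; exact: le_trans e81 te'.
- by split=> x; [apply: H_start; rewrite val0|apply: H_end; rewrite val1].
Qed.

End CellExtension.

(** * Gluing the cells *)

Section PathSpace.
Variables (R : realType) (Z : diffSpace R) (e : R).

Definition tame_path (c : unitI R -> Z) : Prop :=
  smooth c /\ forall (t : unitI R) (a : bool),
    `|(val t : R) - a%:R| <= e -> c t = c (iend R a).

(** The functional diffeology; the map [h] builds in stability under change of parameters. Smooth
    maps from X to this space correspond to smooth homotopies on X times I with tameness constant
    [e], so a universal property of X becomes one for such homotopies. *)
Let pplot n (U : set 'rV[R]_n) (P : 'rV[R]_n -> {c | tame_path c}) : Prop :=
  open U /\ forall m (V : set 'rV[R]_m) (h : 'rV[R]_m -> 'rV[R]_n)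
    (tau : 'rV[R]_m -> unitI R), Cinfty_map V h -> (forall x, V x -> U (h x)) ->
    plot V tau -> plot V (fun x => sval (P (h x)) (tau x)).

Lemma path_plot_open n U P : @pplot n U P -> open U.
Proof. by case. Qed.

Lemma path_plot_ext n U P Q : @pplot n U P ->
  (forall x, U x -> P x = Q x) -> pplot U Q.
Proof.
move=> [oU UP] PQ; split=> // m V h tau Ch VU Vtau.
by apply: plot_ext (UP _ _ _ _ Ch VU Vtau) _ => x /VU/PQ ->.
Qed.

Lemma path_plot_cst n U c : open U -> @pplot n U (cst c).
Proof.
by move=> oU; split=> // m V h tau Ch VU Vtau; case: c => c [sc tc]; exact: sc.
Qed.

Lemma path_plot_local n U P : open U ->
  (forall x, U x -> exists V, [/\ V x, V `<=` U & @pplot n V P]) -> pplot U P.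
Proof.
move=> oU UP; split=> // m V h tau Ch VU Vtau.
have oV := plot_open Vtau; apply: plot_local => // x Vx.
have [V' [V'hx V'U [oV' V'P]]] := UP _ (VU _ Vx).
have oW := open_Cinfty_preimage oV' oV Ch.
exists (V `&` h @^-1` V'); split=> //.
apply: V'P => [j k|y []//|]; first by apply: Ck_sub (Ch j k) => y [].
by apply: plot_sub Vtau oW _ => y [].
Qed.

Lemma path_plot_comp m n U P V h : @pplot n U P -> open V ->
  @Cinfty_map R m n V h -> (forall x, V x -> U (h x)) -> pplot V (P \o h).
Proof.
move=> [oU UP] oV Ch VU; split=> // k W h' tau Ch' WV Wtau.
apply: (UP _ W (h \o h') tau) => // [j i|x /WV/VU//].
by apply: (Ck_comp (plot_open Wtau) WV (Ch j i)) => j'; exact: Ch'.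
Qed.

Definition pathSpace : diffSpace R :=
  DiffSpace path_plot_open path_plot_ext path_plot_cst path_plot_local
    path_plot_comp.

Definition uncurry (X : diffSpace R) (w : X -> pathSpace) (z : prodSpace X (unitI R)) : Z :=
  sval (w z.1) z.2.

Lemma smooth_uncurry (X : diffSpace R) (w : X -> pathSpace) :
  smooth w -> smooth (uncurry w).
Proof.
move=> sw n U q [Uq1 Uq2]; have [_ Uw] := sw _ _ _ Uq1.
by apply: (Uw n U id (snd \o q)) => // j k; exact: Ck_coord.
Qed.

Lemma ex_curry (X : diffSpace R) (F : prodSpace X (unitI R) -> Z) : smooth F ->
  (forall x (t : unitI R) (a : bool), `|(val t : R) - a%:R| <= e ->
    F (x, t) = F (x, iend R a)) ->
  exists2 w : X -> pathSpace, smooth w & forall x t, sval (w x) t = F (x, t).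
Proof.
move=> sF tF.
have tw x : tame_path (fun t => F (x, t)).
  by split=> [|t a]; [apply/smooth_onT; smooth_tac|exact: tF].
exists (fun x => exist _ _ (tw x)) => // n U q Uq.
split=> [|m V h tau Ch VU Vtau /=]; first exact: plot_open Uq.
apply: (sF _ _ (fun x => (q (h x), tau x))); split=> //.
exact: (plot_comp Uq (plot_open Vtau) Ch VU).
Qed.

End PathSpace.

Section Coproducts.
Variables (R : realType) (L : Type) (X : L -> diffSpace R) (Y : diffSpace R).

Lemma smooth_cotuple (f : forall l, X l -> Y) :
  (forall l, smooth (f l)) -> smooth (cotuple f).
Proof.
move=> sf n U p [oU Up]; apply: plot_local => // x /Up[V [l [q [Vx VU Vq pq]]]].
exists V; split=> //; apply: (plot_ext (sf l _ _ _ Vq)) => y Vy.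
by rewrite /= (pq y Vy).
Qed.

Lemma smooth_of_cotuple (f : forall l, X l -> Y) l : smooth (cotuple f) -> smooth (f l).
Proof.
move=> sf n U q Uq; apply: (sf n U (fun x => existT _ l (q x))).
split=> [|x Ux]; first exact: plot_open Uq.
by exists U, l, q; split.
Qed.

End Coproducts.

(** * Induction over the skeleta *)

Section Main.
Variable R : realType.

Lemma extend_skeleton N (X Y Z : diffSpace R) (A : set X) (C : relCW A)
    (p : Y -> Z) (g : X -> Z) n (f : subSpace (skel C n) -> Y)
    (G : prodSpace (subSpace (skel C n)) (unitI R) -> Z) (e : R) :
  gathered C -> N_equivalence N p -> (n <= N)%N -> smooth g ->
  smooth f -> smooth G -> tame_homotopy_eps G e ->
  (forall x, G (x, iend R false) = g (val x)) ->
  (forall x, G (x, iend R true) = p (f x)) ->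
  exists (f' : subSpace (skel C n.+1) -> Y)
    (G' : prodSpace (subSpace (skel C n.+1)) (unitI R) -> Z),
    [/\ smooth f', smooth G', tame_homotopy_eps G' (e / 4),
        (forall x, f' (sub_incl (@skelS _ _ _ C n) x) = f x) /\
        (forall x t, G' (sub_incl (@skelS _ _ _ C n) x, t) = G (x, t)) &
        (forall x, G' (x, iend R false) = g (val x)) /\
        (forall x, G' (x, iend R true) = p (f' x))].
Proof.
move=> gC hp nN sg sf sG tG G0 G1; have sp : smooth p by case: hp.
have [[satt sbd sinc schar comm] univ] := skel_pushout C n.
have e0 : 0 < e <= 2^-1 by case: tG.
have commE l s : sub_incl (@skelS _ _ _ C n) (attach l s) = charmap l (bd_incl s).
  exact: (congr1 (fun F => F (existT _ l s)) comm).
have scl l : smooth (@charmap _ _ _ C n l).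
  exact: (@smooth_of_cotuple R (cell C n) (fun=> cubeSpace R n) _
    (@charmap _ _ _ C n) l schar).
have sal l : smooth (@attach _ _ _ C n l).
  exact: (@smooth_of_cotuple R (cell C n) (fun=> bdcubeSpace R n) _
    (@attach _ _ _ C n) l satt).
have sv : smooth (fun x : subSpace (skel C n.+1) => g (val x)).
  exact: (smooth_comp sg (@smooth_val R _ _)).
have cellP (l : cell C n) := @extend_cell R N _ Y Z p n (attach l) f G
  (fun x => g (val (charmap l x))) e hp nN (sal l) (gC n l) sf
  (smooth_comp sv (scl l)) sG tG G1
  (fun s => etrans (G0 _) (congr1 (fun y => g (val y)) (commE l s))).
have [h /choice[H hH]] := choice cellP.
have [||f' [[sf' f'u f'v] _]] := univ Y f (cotuple h) sf _ _.
- by apply: smooth_cotuple => l; case: (hH l).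
- by apply/funext => -[l s]; case: (hH l) => _ _ _ [E _] _; rewrite /= /cotuple/= E.
(* The collar widths depend on the cell, but the constant e/4 does not, so the homotopies of all
   cells map to one path space; [G] is e-tame and in particular e/4-tame. *)
have [|wG swG wGE] := @ex_curry R Z (e / 4) _ G sG.
  move=> x t a te; case: tG => _; apply; apply: le_trans te _; lra.
have wHex l : exists w : cubeSpace R n -> pathSpace Z (e / 4),
    smooth w /\ forall x t, sval (w x) t = H l (x, t).
  have [_ sH [_ tH] _ _] := hH l.
  by have [w sw wE] := ex_curry sH tH; exists w.
have [wH wHP] := choice wHex.
have path_eq (c c' : pathSpace Z (e / 4)) : (forall t, sval c t = sval c' t) -> c = c'.
  case: c c' => [c tc] [c' tc'] /= /funext cc'; case: c' / cc' in tc' *.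
  by congr exist; exact: Prop_irrelevance.
have [||w [[sw wu wv] _]] := univ (pathSpace Z (e / 4)) wG (cotuple wH) swG _ _.
- by apply: smooth_cotuple => l; case: (wHP l).
- apply/funext => -[l s]; apply: path_eq => t; rewrite /= /cotuple /= wGE.
  by have [_ ->] := wHP l; case: (hH l) => _ _ _ [_ ->].
have wuE x t : sval (w (sub_incl (@skelS _ _ _ C n) x)) t = G (x, t).
  by rewrite -wGE -wu.
have wvE l x t : sval (w (charmap l x)) t = H l (x, t).
  have [_ <-] := wHP l; by have := congr1 (fun F => F (existT _ l x)) wv => /= ->.
have f'uE x : f' (sub_incl (@skelS _ _ _ C n) x) = f x by rewrite -f'u.
have f'vE l x : f' (charmap l x) = h l x.
  by have := congr1 (fun F => F (existT _ l x)) f'v.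
(* The skeleton is known only through its universal property, so the end values of the homotopy are
   identified by the uniqueness clause of the pushout, not point by point. *)
have eqW (k1 k2 : subSpace (skel C n.+1) -> Z) : smooth k1 -> smooth k2 ->
    (forall x, k1 (sub_incl (@skelS _ _ _ C n) x) = k2 (sub_incl (@skelS _ _ _ C n) x)) ->
    (forall l x, k1 (charmap l x) = k2 (charmap l x)) -> k1 = k2.
  move=> s1 s2 E1 E2.
  have [||k [_ ku]] := univ Z (k1 \o sub_incl (@skelS _ _ _ C n))
    (k1 \o cotuple (@charmap _ _ _ C n)) (smooth_comp s1 sinc) _ _.
  - exact: smooth_comp s1 schar.
  - by apply/funext => -[l s] /=; rewrite /cotuple/= commE.
  rewrite -(ku k1) ?(ku k2)//; split=> //; apply/funext => x //=.
  by case: x => l x; rewrite /cotuple/= E2.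
have seval t : smooth (fun x => sval (w x) t).
  have su := smooth_uncurry sw.
  apply/smooth_onT; apply: (@smooth_on_ext _ _ _ _ (fun x => uncurry w (x, t))) => //.
  by smooth_tac.
exists f', (uncurry w); split=> //.
- exact: smooth_uncurry.
- split; first lra.
  by move=> x t a te; rewrite /uncurry /=; have [_ tc] := svalP (w x); exact: tc.
- split=> x.
    apply: (congr1 (fun k => k x) (eqW (fun x => sval (w x) (iend R false))
      (fun x => g (val x)) _ _ _ _)) => //.
    + by move=> y; rewrite wuE G0.
    + by move=> l y; rewrite wvE; case: (hH l) => _ _ _ _ [->].
  apply: (congr1 (fun k => k x) (eqW (fun x => sval (w x) (iend R true))
    (fun x => p (f' x)) _ _ _ _)) => //.
  + exact: smooth_comp.
  + by move=> y; rewrite wuE G1 f'uE.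
  + by move=> l y; rewrite wvE f'vE; case: (hH l) => _ _ _ _ [_ ->].
Qed.

End Main.

Theorem theorem6p3 (R : realType) (N : nat) (X Y Z : diffSpace R) (A : set X)
    (C : relCW A) (hC : gathered C) (hdim : dim_le C N)
    (p : Y -> Z) (hp : N_equivalence N p)
    (f' : subSpace A -> Y) (hf' : smooth f')
    (g : X -> Z) (hg : smooth g)
    (F' : prodSpace (subSpace A) (unitI R) -> Z) (hF' : tame_homotopy F')
    (hF'0 : forall a : subSpace A, F' (a, iend R false) = g (val a))
    (hF'1 : forall a : subSpace A, F' (a, iend R true) = p (f' a)) :
  exists (f : X -> Y) (G : prodSpace X (unitI R) -> Z),
    [/\ smooth f, tame_homotopy G,
        (forall a : subSpace A, f (val a) = f' a),
        (forall (a : subSpace A) (t : unitI R), G (val a, t) = F' (a, t)) &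
        (forall x : X, G (x, iend R false) = g x) /\
        (forall x : X, G (x, iend R true) = p (f x))].
Proof.
have [sF' [e0 tF']] := hF'.
(* [skel C k] has dimension k - 1, so the step from k to k + 1 attaches cells of dimension k <= N.
   Points of [A] and of the skeleton belong to different subspaces of [X] and are compared through
   [val]. *)
have step k : (k <= N.+1)%N -> exists (f : subSpace (skel C k) -> Y)
    (G : prodSpace (subSpace (skel C k)) (unitI R) -> Z) (e : R),
    [/\ smooth f, smooth G, tame_homotopy_eps G e,
        (forall a x, val a = val x -> f x = f' a) /\
        (forall a x t, val a = val x -> G (x, t) = F' (a, t)) &
        (forall x, G (x, iend R false) = g (val x)) /\
        (forall x, G (x, iend R true) = p (f x))].
  elim: k => [_|k IH kN].
    have kA x : (skel C 0 : set X) x -> A x by rewrite skel0.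
    pose i : subSpace (skel C 0) -> subSpace A := sub_incl kA.
    have si : smooth i by [].
    have iE (a : subSpace A) x : val a = val x -> i x = a by move=> ax; exact: val_inj.
    exists (fun x => f' (i x)), (fun z => F' (i z.1, z.2)), e0; split.
    - exact: smooth_comp.
    - by apply/smooth_onT; smooth_tac.
    - by case: tF' => e1 tF'; split=> // x t a; exact: tF'.
    - by split=> [a x /iE ->|a x t /iE /= ->].
    - by split=> x /=; rewrite ?hF'0 ?hF'1.
  have [f [G [e [sf sG tG [fA GA] [G0 G1]]]]] := IH (ltnW kN).
  have [f1 [G1' [sf1 sG1 tG1 [f1E G1E] [G10 G11]]]] :=
    extend_skeleton hC hp kN hg sf sG tG G0 G1.
  exists f1, G1', (e / 4); split=> //.
  have skA (a : subSpace A) : exists y : subSpace (skel C k), val y = val a.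
    have : A `<=` skel C k.
      elim: (k) => [|j Aj]; first by rewrite skel0.
      exact: subset_trans Aj (@skelS _ _ _ C j).
    by move=> Ak; exists (sub_incl Ak a).
  split=> [a x ax|a x t ax]; have [y ya] := skA a.
    have -> : x = sub_incl (@skelS _ _ _ C k) y by apply: val_inj; rewrite -ax -ya.
    by rewrite f1E; exact: fA.
  have -> : x = sub_incl (@skelS _ _ _ C k) y by apply: val_inj; rewrite -ax -ya.
  by rewrite G1E; exact: GA.
(* The constant has been divided by 4 only n + 1 times, so it is still positive. *)
have [n nN dimn] := hdim.
have [f [G [e [sf sG tG [fA GA] [G0 G1]]]]] := step n.+1 nN.
have inT (x : X) : x \in skel C n.+1 by rewrite dimn inE.
pose i x : subSpace (skel C n.+1) := exist _ x (inT x).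
have si : smooth i by [].
exists (fun x => f (i x)), (fun z => G (i z.1, z.2)); split.
- exact: smooth_comp.
- split; first by apply/smooth_onT; smooth_tac.
  by exists e; case: tG => e1 tG; split=> // x t a; exact: tG.
- by move=> a; exact: fA.
- by move=> a t; exact: GA.
- by split=> x /=; rewrite ?G0 ?G1.
Qed.
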